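(* Let $G=L\ltimes U$ be an algebra group extension over $\mathbb{F}_q$, with $U=1+J$. Then the system of characters $\{\chi'_\alpha:\ \alpha\in\mathcal{A}'\}$ together with the system of subsets $\{K'_\beta:\ \beta\in\mathcal{B}'\}$ is a supercharacter theory of the group $G$.
   Context: **Supercharacter theory.** A supercharacter theory of a finite group $G$ is a pair $(\mathfrak{S},\mathcal{K})$, where $\mathfrak{S}=\{\chi_1,\dots,\chi_m\}$ is a system of pairwise orthogonal complex characters of $G$ and $\mathcal{K}=\{K_1,\dots,K_m\}$ is a partition of $G$ (the same number $m$ of characters and of classes), such that each $\chi_i$ is constant on each $K_j$ and $\{1\}\in\mathcal{K}$. **Algebra group extension.** Let $\mathbb{F}_q$ be a finite field and $J$ a finite-dimensional associative nilpotent $\mathbb{F}_q$-algebra; $U=1+J$ is the group with multiplication $(1+x)(1+y)=1+x+y+xy$. Let $L$ be a finite group with an $\mathbb{F}_q$-linear left action and an $\mathbb{F}_q$-linear right action on $J$ which commute with each other and satisfy $h(xy)=(hx)y$, $(xy)h=x(yh)$, $x(hy)=(xh)y$ for all $x,y\in J$, $h\in L$. Then $\mathrm{Ad}_h(1+x)=1+hxh^{-1}$ defines a homomorphism $\mathrm{Ad}:L\to\mathrm{Aut}(U)$, and $G=L\ltimes U$ is the corresponding semidirect product. Each element of $G$ is uniquely $g=h(1+x)$, $h\in L$, $x\in J$. The group $G$ acts on $J$ on the left and on the right: for $g=hu$ ($h\in L$, $u\in U$), $gx=h(ux)$ and $xg=(xh)u$, where $(1+y)x=x+yx$, $x(1+y)=x+xy$.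 On the dual space $J^*$, $G$ acts on the left by $(g\lambda)(x)=\lambda(xg)$ and on the right by $(\lambda g)(x)=\lambda(gx)$; for $h\in L$ put $\mathrm{Ad}^*_h(\lambda)=h\lambda h^{-1}$. **Characters.** Fix a nontrivial character $t\mapsto\varepsilon^t$ of the additive group of $\mathbb{F}_q$ with values in $\mathbb{C}^*$. For $\lambda\in J^*$ let $J_{\lambda,\mathrm{right}}=\{y\in J:\ \lambda(yx)=0 \text{ for all } x\in J\}$ and $U_{\lambda,\mathrm{right}}=1+J_{\lambda,\mathrm{right}}$. The $G\times U$ orbit of $\lambda$ in $J^*$ is $G\lambda U$. Let $H_{G\lambda U}=\{h\in L:\ \mathrm{Ad}^*_h(\mu)=\mu \text{ for all }\mu\in G\lambda U\}$ and $S_{G\lambda U}=\{r\in L:\ \mathrm{Ad}_r^*(G\lambda U)=G\lambda U\}$; $H_{G\lambda U}$ is normal in $S_{G\lambda U}$, and both depend only on the orbit. For a normal subgroup $N$ of a group $S$, an $S$-irreducible character of $N$ is the sum of the distinct irreducible complex characters of $N$ in one $S$-conjugation orbit. Let $\mathcal{A}'_0$ be the set of pairs $(\theta,\lambda)$, where $\lambda$ runs through representatives of the $G\times U$ orbits in $J^*$ (so $\lambda$ stands for the orbit $G\lambda U$) and $\theta$ runs through the $S_{G\lambda U}$-irreducible characters of $H_{G\lambda U}$. The group $L$ acts on $\mathcal{A}'_0$ by conjugation: $r\in L$ sends the orbit $G\lambda U$ to $r(G\lambda U)r^{-1}$ and $\theta$ to the character $h\mapsto\theta(r^{-1}hr)$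 of $rH_{G\lambda U}r^{-1}$. Let $\mathcal{A}'$ be the set of $L$-orbits in $\mathcal{A}'_0$. For $\alpha\in\mathcal{A}'$ represented by $(\theta,\lambda)$ put $H_0=H_{G\lambda U}$ and $G_{0,\lambda}=H_0\ltimes U_{\lambda,\mathrm{right}}$; for $p\in L$ the formula $\xi_{\theta,p\lambda}(h(1+x))=\theta(h)\varepsilon^{(p\lambda)(x)}$ ($h\in H_0$, $x\in J_{\lambda,\mathrm{right}}$) defines a character of $G_{0,\lambda}$, and $\chi'_\alpha$ is the character of $G$ induced from the character $\sum_{p\in L}\xi_{\theta,p\lambda}$ of $G_{0,\lambda}$. **Classes.** For $h\in L$, the sum of all linear spans $\langle G\lambda U\rangle$ over those $\lambda\in J^*$ with $h\in H_{G\lambda U}$ is the largest $G\times U$-invariant subspace of $J^*$ on which $\mathrm{Ad}^*_h$ acts as the identity; its orthogonal complement in $J$ is denoted $J'_h$ (a two-sided ideal of $J$ invariant under right multiplication by $L$). Let $\pi'_h:J\to J/J'_h$ be the natural projection. Let $\mathcal{B}'_0$ be the set of pairs $(h,\omega)$, where $h\in L$ and $\omega$ is a $U\times G$ orbit in $J/J'_h$ ($U$ acting by left and $G$ by right multiplication). The group $L$ acts on $\mathcal{B}'_0$ by conjugation, $r\cdot(h,\omega)=(rhr^{-1},r\omega r^{-1})$ (note $rJ'_hr^{-1}=J'_{rhr^{-1}}$); let $\mathcal{B}'$ be the set of $L$-orbits. For $\beta\in\mathcal{B}'$ represented by $(h,\omega)$ put $K'_\beta=\bigcup_{p\in L}p\,\bigl(h(1+(\pi'_h)^{-1}(\omega))\bigr)\,p^{-1}$.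 *)

(* Defs.v *)
From HB Require Import structures.
From mathcomp Require Import all_boot all_order all_fingroup all_algebra.
From mathcomp Require Import all_solvable all_field all_character.

Set Implicit Arguments.
Unset Strict Implicit.
Unset Printing Implicit Defensive.

Import GroupScope GRing.Theory.
Local Open Scope ring_scope.

(* A system chi_1, ..., chi_m of characters together with a system K_1, ...,  *)
(* K_m of subsets. [pairwise_orthogonal] also says that no chi_i is zero (in  *)
(* the library 0 counts as a character), hence that the chi_i are distinct;   *)
(* [uniq K] says that distinct indices give distinct blocks.                  *)
Definition supercharacter_theory (gT : finGroupType) (G : {group gT})
    (chi : seq 'CF(G)) (K : seq {set gT}) : Prop :=
  [/\ size chi = size K,
      {subset chi <= character} /\ pairwise_orthogonal chi,
      uniq K /\ partition [set:: K] G,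
      forall phi X, phi \in chi -> X \in K -> {in X &, forall x y, phi x = phi y}
    & [set 1%g] \in K].

Section AlgExt.

Variables (F : finFieldType) (J : vectType F) (L : finGroupType).
Local Notation fJ := (finvect_type J).

(* A finite-dimensional associative nilpotent algebra structure on J, with    *)
(* compatible commuting linear left and right actions of L. Nilpotency: all   *)
(* products of n + 1 elements vanish for some n.                              *)
Record alg_ext := AlgExt {
  amul : fJ -> fJ -> fJ;
  lact : L -> fJ -> fJ;
  ract : fJ -> L -> fJ;
  amul_linear_l : forall y, linear (amul^~ y);
  amul_linear_r : forall x, linear (amul x);
  amulA : associative amul;
  amul_nilp : exists n, forall x (s : n.-tuple fJ), foldl amul x s = 0;
  lact_linear : forall h, linear (lact h);
  ract_linear : forall h, linear (ract^~ h);
  lact1 : forall x, lact 1%g x = x;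
  lactM : forall h k x, lact (h * k)%g x = lact h (lact k x);
  ract1 : forall x, ract x 1%g = x;
  ractM : forall h k x, ract x (h * k)%g = ract (ract x h) k;
  lractC : forall h k x, ract (lact h x) k = lact h (ract x k);
  lact_amul : forall h x y, lact h (amul x y) = amul (lact h x) y;
  amul_ract : forall h x y, ract (amul x y) h = amul x (ract y h);
  amul_lact : forall h x y, amul x (lact h y) = amul (ract x h) y
}.

End AlgExt.

(* The group U = 1 + J; [OnePlus E x] stands for 1 + x. The parameter E is    *)
(* there for the group law to be inferred from the type.                      *)
Record one_plus (F : finFieldType) (J : vectType F) (L : finGroupType)
    (E : alg_ext J L) : predArgType :=
  OnePlus { rad : finvect_type J }.

Section UnitGroup.

Variables (F : finFieldType) (J : vectType F) (L : finGroupType).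
Variable E : alg_ext J L.

Local Notation fJ := (finvect_type J).
Implicit Types (x y z : fJ) (h k r : L).

Lemma amulDl x y z : amul E (x + y) z = amul E x z + amul E y z.
Proof. by have := amul_linear_l E z 1 x y; rewrite !scale1r. Qed.

Lemma amulDr x y z : amul E x (y + z) = amul E x y + amul E x z.
Proof. by have := amul_linear_r E x 1 y z; rewrite !scale1r. Qed.

Lemma amul0l x : amul E 0 x = 0.
Proof. by apply: (addrI (amul E 0 x)); rewrite -amulDl !addr0. Qed.

Lemma amul0r x : amul E x 0 = 0.
Proof. by apply: (addrI (amul E x 0)); rewrite -amulDr !addr0. Qed.

Lemma amulNl x y : amul E (- x) y = - amul E x y.
Proof. by apply: (addrI (amul E x y)); rewrite -amulDl !subrr amul0l. Qed.

Lemma lactD h x y : lact E h (x + y) = lact E h x + lact E h y.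
Proof. by have := lact_linear E h 1 x y; rewrite !scale1r. Qed.

Lemma ractD h x y : ract E (x + y) h = ract E x h + ract E y h.
Proof. by have := ract_linear E h 1 x y; rewrite !scale1r. Qed.

Local Notation one_plus := (one_plus E).
Local Notation OnePlus := (OnePlus E).

HB.instance Definition _ := [isNew for (@rad F J L E)].
HB.instance Definition _ := [Finite of one_plus by <:].

Definition U_one := OnePlus 0.
Definition U_mul (u v : one_plus) :=
  OnePlus (rad u + rad v + amul E (rad u) (rad v)).
Definition U_inv (u : one_plus) : one_plus :=
  odflt U_one [pick v | U_mul v u == U_one].

Lemma U_mulA : associative U_mul.
Proof.
move=> [x] [y] [z]; congr OnePlus; rewrite /= !amulDl !amulDr amulA !addrA.
rewrite -!addrA; congr (_ + (_ + _)).
rewrite [RHS]addrCA; congr (_ + _); rewrite addrCA; congr (_ + _).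
by rewrite addrCA.
Qed.

Lemma U_mul1 : left_id U_one U_mul.
Proof. by case=> x; congr OnePlus; rewrite /= amul0l add0r addr0. Qed.

Lemma U_mulV : left_inverse U_one U_inv U_mul.
Proof.
move=> u; rewrite /U_inv; case: pickP => [v /eqP // | /= noinv]; exfalso.
pose x := rad u; pose f y : fJ := - (x + amul E y x).
have amulNr y z : amul E y (- z) = - amul E y z.
  by apply: (addrI (amul E y z)); rewrite -amulDr !subrr amul0r.
have fB y z : f y - f z = amul E (y - z) (- x).
  by rewrite amulNr amulDl amulNl /f !opprD !opprK addrACA addNr add0r.
have dE n : iter n.+1 f 0 - iter n f 0 = foldl (amul E) (- x) (nseq n (- x)).
  elim: n => [|n IHn]; first by rewrite /= /f amul0l addr0 subr0.
  by rewrite -[n.+1 in RHS]addn1 nseqD foldl_cat /= -IHn -fB.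
have [n nilp] := amul_nilp E; have := dE n.
rewrite (nilp _ [tuple of nseq n (- x)]) => /eqP.
rewrite subr_eq0 => /eqP /= fix_y; case/negP: (negbT (noinv (OnePlus (iter n f 0)))).
apply/eqP; congr OnePlus; rewrite /= -/x -addrA.
by rewrite -{1}fix_y addNr.
Qed.

HB.instance Definition _ :=
  Finite_isGroup.Build one_plus U_mulA U_mul1 U_mulV.

(* h x h^-1 and Ad_h(1 + x) = 1 + h x h^-1 *)
Definition Jconj h x : fJ := ract E (lact E h x) h^-1.
Definition Ad h (u : one_plus) : one_plus := OnePlus (Jconj h (rad u)).

Lemma JconjM h k x : Jconj (h * k)%g x = Jconj h (Jconj k x).
Proof. by rewrite /Jconj invMg ractM lactM !lractC. Qed.

Lemma Jconj1 x : Jconj 1%g x = x.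
Proof. by rewrite /Jconj invg1 ract1 lact1. Qed.

Lemma JconjD h x y : Jconj h (x + y) = Jconj h x + Jconj h y.
Proof. by rewrite /Jconj lactD ractD. Qed.

Lemma Jconj_amul h x y : Jconj h (amul E x y) = amul E (Jconj h x) (Jconj h y).
Proof.
by rewrite /Jconj lact_amul amul_ract (lractC E h _ y) amul_lact -ractM mulVg ract1.
Qed.

(* The library's semidirect product uses right actions, with                  *)
(* [to u h = h^-1 * u * h]; hence the inverse.                                *)
Definition Ad_to (u : one_plus) h := Ad h^-1 u.

Lemma Ad_to1 : Ad_to^~ 1%g =1 id.
Proof. by case=> x; rewrite /Ad_to invg1 /Ad Jconj1. Qed.

Lemma Ad_toM u : act_morph Ad_to u.
Proof. by move=> h k; rewrite /Ad_to invMg /Ad JconjM. Qed.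

Definition Ad_action := TotalAction Ad_to1 Ad_toM.

Lemma Ad_is_groupAction : is_groupAction [set: one_plus] Ad_action.
Proof.
move=> h _; rewrite inE; apply/andP; split; first by apply/subsetP=> u; rewrite inE.
apply/morphicP=> u v _ _; rewrite !actpermE; congr OnePlus.
by rewrite /= -Jconj_amul -!JconjD.
Qed.

Definition Ad_gact := GroupAction Ad_is_groupAction.

End UnitGroup.

(* G = L |x U; the element h(1 + x) is the pair (h, 1 + x), see [eltE].       *)
Notation algG E := (sdprod_by (Ad_gact E)).

Section Supercharacters.

Variables (F : finFieldType) (J : vectType F) (L : finGroupType).
Variable E : alg_ext J L.

Local Notation fJ := (finvect_type J).
Local Notation U := (one_plus E).
Local Notation G := (algG E).

Implicit Types (x y z : fJ) (h k p r : L) (u v : U) (g : G).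

Definition inL h : G := sdpair2 (Ad_gact E) h.
Definition inU u : G := sdpair1 (Ad_gact E) u.
Definition elt h x : G := (inL h * inU (OnePlus E x))%g.

Definition Lpart g : L := g.1.
Definition Jpart g : fJ := rad g.2.

Lemma Lpart_inL h : Lpart (inL h) = h.
Proof. by rewrite /Lpart /inL /sdpair2 val_insubd !inE. Qed.
Lemma Jpart_inL h : Jpart (inL h) = 0.
Proof. by rewrite /Jpart /inL /sdpair2 val_insubd !inE. Qed.
Lemma Lpart_inU u : Lpart (inU u) = 1%g.
Proof. by rewrite /Lpart /inU /sdpair1 val_insubd !inE. Qed.
Lemma Jpart_inU u : Jpart (inU u) = rad u.
Proof. by rewrite /Jpart /inU /sdpair1 val_insubd !inE. Qed.

Lemma Lpart1 : Lpart 1%g = 1%g. Proof. by []. Qed.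
Lemma Jpart1 : Jpart 1%g = 0. Proof. by []. Qed.

Lemma LpartM g g' : Lpart (g * g')%g = (Lpart g * Lpart g')%g.
Proof. by []. Qed.

Lemma JpartM g g' (x := Jconj E (Lpart g')^-1 (Jpart g)) (y := Jpart g') :
  Jpart (g * g')%g = x + y + amul E x y.
Proof. by []. Qed.

Lemma Lpart_elt h x : Lpart (elt h x) = h.
Proof. by rewrite LpartM Lpart_inL Lpart_inU mulg1. Qed.

Lemma Jconj0 h : Jconj E h 0 = 0.
Proof. by apply: (addrI (Jconj E h 0)); rewrite -JconjD !addr0. Qed.

Lemma Jpart_elt h x : Jpart (elt h x) = x.
Proof.
by rewrite JpartM Jpart_inL Jpart_inU Jconj0 amul0l addr0 add0r.
Qed.

Lemma eltE g : elt (Lpart g) (Jpart g) = g.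
Proof. by rewrite [RHS]sdpairE /elt /inU /Jpart; case: (g.2). Qed.

(* g x = h(x + y x) and x g = x h + (x h) y for g = h(1 + y) *)
Definition lmul g x : fJ := lact E (Lpart g) (x + amul E (Jpart g) x).
Definition rmul x g : fJ :=
  ract E x (Lpart g) + amul E (ract E x (Lpart g)) (Jpart g).

Lemma lmul_linear g : linear (lmul g).
Proof.
move=> a x y; rewrite /lmul (amul_linear_r E (Jpart g)) -lact_linear.
by rewrite scalerDr addrACA.
Qed.

Lemma rmul_linear g : linear (rmul^~ g).
Proof.
move=> a x y; rewrite /rmul (ract_linear E (Lpart g)).
by rewrite (amul_linear_l E (Jpart g)) scalerDr addrACA.
Qed.

Lemma lmul_inL h x : lmul (inL h) x = lact E h x.
Proof. by rewrite /lmul Lpart_inL Jpart_inL amul0l addr0. Qed.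

Lemma rmul_inL h x : rmul x (inL h) = ract E x h.
Proof. by rewrite /rmul Lpart_inL Jpart_inL amul0r addr0. Qed.

Lemma lmul1 x : lmul 1%g x = x.
Proof. by rewrite /lmul Lpart1 Jpart1 amul0l addr0 lact1. Qed.

Lemma rmul1 x : rmul x 1%g = x.
Proof. by rewrite /rmul Lpart1 Jpart1 amul0r addr0 ract1. Qed.

Lemma lmulM g g' x : lmul (g * g')%g x = lmul g (lmul g' x).
Proof.
rewrite /lmul LpartM JpartM lactM; congr (lact E _ _).
set h := Lpart g'; set a := Jpart g; set b := Jpart g'.
have JconjE z : lact E h (amul E (Jconj E h^-1 a) z) = amul E a (lact E h z).
  by rewrite /Jconj invgK -amul_lact lact_amul -lactM mulgV lact1.
rewrite -JconjE -lactD amulDr !amulDl -amulA -!addrA.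
by congr (lact E _ (_ + _)); rewrite addrCA.
Qed.

Lemma rmulM g g' x : rmul x (g * g')%g = rmul (rmul x g) g'.
Proof.
rewrite /rmul LpartM JpartM ractM.
set h := Lpart g'; set a := Jpart g; set b := Jpart g'; set y := ract E x _.
have JconjE : amul E (ract E y h) (Jconj E h^-1 a) = ract E (amul E y a) h.
  by rewrite -amul_lact /Jconj invgK -lractC -lactM mulgV lact1 amul_ract.
by rewrite !amulDr ractD amulDl amulA JconjE !addrA (addrAC _ (amul E _ b)).
Qed.

Lemma lrmulC g g' x : rmul (lmul g x) g' = lmul g (rmul x g').
Proof.
rewrite /lmul /rmul lractC ractD amul_ract -lact_amul -lactD.
by rewrite amulDl amulDr -amulA addrACA.
Qed.

Definition dual := finvect_type 'Hom(J, F^o).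
Implicit Types (lam mu : dual) (O : {set dual}).

Definition dlmul g lam : dual := linfun (fun x => lam (rmul x g)).
Definition drmul lam g : dual := linfun (fun x => lam (lmul g x)).

Lemma linfunE (f : J -> F^o) : linear f -> linfun f =1 f.
Proof.
move=> lin_f; have hf := GRing.isLinear.Build F J F^o *:%R f lin_f.
pose g : {linear J -> F^o} := HB.pack f hf.
exact: (lfunE g).
Qed.

Lemma dlmulE g lam x : dlmul g lam x = lam (rmul x g).
Proof.
apply: linfunE => a y z /=.
by have -> := rmul_linear g a y z; rewrite linearP.
Qed.

Lemma drmulE g lam x : drmul lam g x = lam (lmul g x).
Proof.
apply: linfunE => a y z /=.
by have -> := lmul_linear g a y z; rewrite linearP.
Qed.

Definition Adst h lam : dual := dlmul (inL h) (drmul lam (inL h^-1)).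

Lemma AdstE h lam x : Adst h lam x = lam (Jconj E h^-1 x).
Proof. by rewrite dlmulE drmulE lmul_inL rmul_inL /Jconj invgK lractC. Qed.

Lemma AdstM h k lam : Adst (h * k)%g lam = Adst h (Adst k lam).
Proof. by apply/lfunP=> x; rewrite !AdstE invMg JconjM. Qed.

Lemma Adst1 lam : Adst 1%g lam = lam.
Proof. by apply/lfunP=> x; rewrite !AdstE invg1 Jconj1. Qed.

Definition GU lam : {set dual} :=
  [set dlmul g (drmul lam (inU u)) | g : G, u : U].

Lemma mem_GU p lam : dlmul (inL p) lam \in GU lam.
Proof.
apply/imset2P; exists (inL p) 1%g; rewrite ?inE //; congr (dlmul _ _).
by apply/lfunP=> x; rewrite drmulE /inU morph1 lmul1.
Qed.

Lemma GU_refl lam : lam \in GU lam.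
Proof.
have lamE : dlmul (inL 1%g) lam = lam.
  by apply/lfunP=> x; rewrite dlmulE /inL morph1 rmul1.
by rewrite -{1}lamE mem_GU.
Qed.

Definition GU_orbits : {set {set dual}} := [set GU lam | lam : dual].

Definition Hstab O := [set h | [forall mu in O, Adst h mu == mu]].
Definition Sstab O := [set r | [set Adst r mu | mu in O] == O].

Lemma Hstab_group_set O : group_set (Hstab O).
Proof.
apply/group_setP; split=> [|h k].
  by rewrite inE; apply/forall_inP=> mu _; rewrite Adst1.
rewrite !inE => /forall_inP fix_h /forall_inP fix_k; apply/forall_inP=> mu Omu.
by rewrite AdstM (eqP (fix_k _ Omu)) fix_h.
Qed.
Canonical Hstab_group O := Group (Hstab_group_set O).

Lemma Sstab_group_set O : group_set (Sstab O).
Proof.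
apply/group_setP; split=> [|h k].
  by rewrite inE; apply/eqP; rewrite -[RHS]imset_id; apply: eq_imset => mu;
     rewrite Adst1.
rewrite !inE => /eqP fix_h /eqP fix_k; apply/eqP.
rewrite -[RHS]fix_h -[in RHS]fix_k -imset_comp.
by apply: eq_imset => mu; apply: AdstM.
Qed.
Canonical Sstab_group O := Group (Sstab_group_set O).

(* The S-irreducible characters of N; [('chi_i ^: S)%CF] lists the distinct   *)
(* S-conjugates of 'chi_i.                                                    *)
Definition rel_irr (N S : {group L}) : seq 'CF(N) :=
  [seq \sum_(phi <- ('chi_i ^: S)%CF) phi | i : Iirr N].

Definition Jright lam : {set fJ} :=
  [set y : fJ | [forall x : fJ, lam (amul E y x) == 0]].

Definition G0 lam : {set G} :=
  [set g | (Lpart g \in Hstab (GU lam)) && (Jpart g \in Jright lam)].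

Lemma mem_G0 lam g : (g \in G0 lam) =
  (Lpart g \in Hstab (GU lam)) && (Jpart g \in Jright lam).
Proof. by rewrite [LHS]inE. Qed.

Lemma Hstab_Jconj lam h mu x :
  h \in Hstab (GU lam) -> mu \in GU lam -> mu (Jconj E h^-1 x) = mu x.
Proof.
by rewrite inE => /forall_inP fix_h /fix_h/eqP fix_mu; rewrite -AdstE fix_mu.
Qed.

Lemma JrightP lam y :
  reflect (forall x, lam (amul E y x) = 0) (y \in Jright lam).
Proof. by rewrite inE; apply: (iffP forallP) => H x; apply/eqP/H. Qed.

Lemma Jright_Jconj lam h y :
  h \in Hstab (GU lam) -> y \in Jright lam -> Jconj E h^-1 y \in Jright lam.
Proof.
move=> Hh /JrightP y0; apply/JrightP=> x.
rewrite -[x](@Jconj1 _ _ _ E) -(mulVg h) JconjM -Jconj_amul.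
by rewrite (Hstab_Jconj _ Hh) ?GU_refl // y0.
Qed.

Lemma G0_group_set lam : group_set (G0 lam).
Proof.
apply/group_setP; split=> [|g k].
  rewrite mem_G0 Lpart1 Jpart1 group1; apply/JrightP=> x.
  by rewrite amul0l linear0.
rewrite !mem_G0 => /andP[Hg Jg] /andP[Hk Jk].
rewrite LpartM groupM //=; apply/JrightP=> x; rewrite JpartM.
have /JrightP Jg' := Jright_Jconj Hk Jg; have /JrightP Jk' := Jk.
by rewrite !amulDl !linearD /= Jg' Jk' -amulA Jg' !addr0.
Qed.
Canonical G0_group lam := Group (G0_group_set lam).

Lemma G0_additive lam p :
  {in G0 lam &, forall g g', dlmul (inL p) lam (Jpart (g * g')%g) =
    dlmul (inL p) lam (Jpart g) + dlmul (inL p) lam (Jpart g')}.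
Proof.
move=> g k; rewrite !mem_G0 => /andP[Hg Jg] /andP[Hk Jk].
rewrite JpartM !linearD /= (Hstab_Jconj _ Hk) ?mem_GU //.
rewrite [X in _ + X]dlmulE rmul_inL amul_ract.
by have /JrightP -> := Jright_Jconj Hk Jg; rewrite addr0.
Qed.

Variable eps : F -> algC.

Lemma xi_class_fun lam (theta : 'CF(Hstab (GU lam))) p :
  is_class_fun <<G0 lam>> [ffun g =>
    theta (Lpart g) * eps (dlmul (inL p) lam (Jpart g)) *+ (g \in G0 lam)].
Proof.
rewrite genGid; apply: intro_class_fun => [g k Gg Gk | g /negPf-> //].
rewrite memJ_norm ?(subsetP (normG _)) //= Gg.
have [Hg Hk] : Lpart g \in Hstab (GU lam) /\ Lpart k \in Hstab (GU lam).
  by move: Gg Gk; rewrite !mem_G0 => /andP[? _] /andP[? _].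
have -> : Lpart (g ^ k)%g = (Lpart g ^ Lpart k)%g.
  by apply: (mulgI (Lpart k)); rewrite -LpartM -!conjgC LpartM.
rewrite cfunJ //; congr (_ * eps _ *+ _).
apply: (addrI (dlmul (inL p) lam (Jpart k))).
by rewrite -G0_additive ?groupJ // -conjgC G0_additive // addrC.
Qed.

Definition xi lam (theta : 'CF(Hstab (GU lam))) p : 'CF(G0 lam) :=
  Cfun 0 (xi_class_fun theta p).

Definition schar lam (theta : 'CF(Hstab (GU lam))) : 'CF([set: G]) :=
  'Ind[[set: G], G0 lam] (\sum_(p : L) xi theta p).

(* Pairs (theta, lambda), lambda coming first because the group on which      *)
(* theta lives depends on it.                                                 *)
Definition Apair := {lam : dual & 'CF(Hstab (GU lam))}.

(* T is a set of representatives of the G x U orbits. *)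
Definition A0_seq (T : {set dual}) : seq Apair :=
  [seq Tagged (fun lam => 'CF(Hstab (GU lam))) theta
    | lam <- enum T,
      theta <- rel_irr (Hstab_group (GU lam)) (Sstab_group (GU lam))].

Definition A0 T := seq_sub (A0_seq T).

(* b = r . a; the orbits of tag a and tag b are compared, not tag a and tag b *)
(* themselves. Here [h ^ r] is r^-1 h r.                                      *)
Definition A_conj r (a b : Apair) :=
  (GU (tag b) == [set Adst r mu | mu in GU (tag a)]) &&
  [forall h, tagged b h == tagged a (h ^ r)%g].

Definition A_orbits T : {set {set A0 T}} :=
  [set [set b : A0 T | [exists r, A_conj r (ssval a) (ssval b)]] | a : A0 T].

Definition schar_of (a : Apair) : 'CF([set: G]) := schar (tagged a).

(* J'_h and the coset x + J'_h *)
Definition fixed_span h : {vspace 'Hom(J, F^o)} :=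
  (\sum_(lam : dual | h \in Hstab (GU lam)) <<enum (GU lam)>>)%VS.
Definition Jprime h : {set fJ} :=
  [set x : fJ | [forall mu : dual, (mu \in fixed_span h) ==> (mu x == 0)]].
Definition Jproj h x : {set fJ} := [set x + y | y in Jprime h].

(* U x G orbit of a coset, the translate u(x + J'_h)g being computed          *)
(* elementwise.                                                               *)
Definition UG (C : {set fJ}) : {set {set fJ}} :=
  [set [set lmul (inU u) (rmul y g) | y in C] | u : U, g : G].

Definition B0 : {set L * {set {set fJ}}} :=
  [set b | [exists x, b.2 == UG (Jproj b.1 x)]].

Definition B_conj r (b : L * {set {set fJ}}) : L * {set {set fJ}} :=
  ((b.1 ^ r^-1)%g, [set [set Jconj E r x | x in C] | C : {set fJ} in b.2]).

Definition B_orbits : {set {set L * {set {set fJ}}}} :=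
  [set [set B_conj r b | r : L] | b in B0].

Definition sclass (b : L * {set {set fJ}}) : {set G} :=
  \bigcup_(p : L) [set elt b.1 x | x in Jproj b.1 @^-1: b.2] :^ (inL p)^-1.

End Supercharacters.

(* Main.v *)
Require Import Defs.
From mathcomp Require Import all_boot all_order all_fingroup all_algebra.
From mathcomp Require Import all_solvable all_field all_character.

Import GroupScope GRing.Theory Num.Theory.
Local Open Scope ring_scope.

(** Write y = h(1 + x) for an element of G. Let G x G act on J by
    (k, g) : x |-> k^-1 x g, and dually on J* by lam |-> g lam k^-1; the G x U
    orbits on J* are the orbits of the pairs with k in U, and conjugation by r
    in L is the pair (r, r). On J/J'_h the automorphism Ad_h is trivial, and
    this makes conjugation in G linear modulo J': the J-part of y^k is
    k^-1 x k up to an element of J'_{h^k} ([JpartJ]). Two things follow.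

    First, the superclasses are the classes of the relation generated by
    (h, x) ~ (h^k, k^-1 x g) for k, g in G and x ~ x + d for d in J'_h
    ([superclass_rel], [mem_label_orbit], [mem_sclass]); hence they partition G.

    Second, the induced character has a closed form ([schar_formula]):
      chi'(h(1 + x)) =
        c * sum over k, g in G of theta(h^k) eps(lam(k^-1 x g)),  with c > 0.
    The form is visibly constant on superclasses. Moreover, for f constant on
    superclasses all terms (k, g) contribute equally to the scalar product with
    chi', so that this product is, up to a nonzero scalar,
      sum over h in H of F_h(lam) * conj theta(h),
    where F_h is the Fourier transform of x |-> f(h(1 + x))
    ([sum_schar_pairing]).

    Orthogonality: for f another chi', coming from (theta', lam'), F_h(lam)
    vanishes unless lam lies in g lam' k^-1 for some k, g, and then the sum is a
    scalar product of two S-irreducible characters of H; so it vanishes unless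
    the two pairs are conjugate under L ([pairing_schar],
    [schar_of_orthogonal]).

    Completeness: if f is constant on superclasses and orthogonal to all chi',
    then f = 0 ([chi_complete]). Indeed F_h(lam) = 0 for h outside H because f
    is J'_h-invariant ([fourier_supp]); on H, the function h |-> F_h(lam) is an
    S-invariant class function orthogonal to all the S-irreducible characters,
    hence zero ([fourier_eq0_of_pairing]); and Fourier inversion gives f = 0.

    Orthogonality and completeness together force the number of characters to
    be the number of superclasses ([size_chi_K]). *)

Set Implicit Arguments.
Unset Strict Implicit.
Unset Printing Implicit Defensive.

(** * The two-sided action on J and its dual, and the ideals J'_h *)

Section Algebra.

Variables (F : finFieldType) (J : vectType F) (L : finGroupType).
Variable E : alg_ext J L.

Local Notation fJ := (finvect_type J).
Local Notation U := (one_plus E).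
Local Notation G := (algG E).
Local Notation dJ := (dual J).

Implicit Types (x y z d : fJ) (h r : L) (u v : U) (g k : G) (lam mu : dJ).

(** The left factor is inverted so that [biact] is a right action of G x G. Letting
    k range over G and not only over U puts conjugation by L, the diagonal
    case, on the same footing as the U x G action. *)
Definition biact k g x : fJ := lmul k^-1%g (rmul x g).
Definition dbiact k g lam : dJ := dlmul g (drmul lam k^-1%g).
Arguments biact (k g)%_g x%_R.
Arguments dbiact (k g)%_g lam%_R.

Lemma dbiactE k g lam x : dbiact k g lam x = lam (biact k g x).
Proof. by rewrite dlmulE drmulE. Qed.

Lemma biactM k k' g g' x : biact k' g' (biact k g x) = biact (k * k') (g * g') x.
Proof. by rewrite /biact invMg lmulM rmulM lrmulC. Qed.

Lemma biact1 x : biact 1 1 x = x.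
Proof. by rewrite /biact invg1 lmul1 rmul1. Qed.

Lemma biactK k g : cancel (biact k g) (biact k^-1 g^-1).
Proof. by move=> x; rewrite biactM !mulgV biact1. Qed.

Lemma biactKV k g : cancel (biact k^-1 g^-1) (biact k g).
Proof. by move=> x; rewrite biactM !mulVg biact1. Qed.

Lemma biact_inj k g : injective (biact k g).
Proof. exact: can_inj (biactK k g). Qed.

Lemma biact_linear k g : linear (biact k g).
Proof. by move=> a x y; rewrite /biact rmul_linear lmul_linear. Qed.

Lemma biactD k g x y : biact k g (x + y) = biact k g x + biact k g y.
Proof. by have := biact_linear k g 1 x y; rewrite !scale1r. Qed.

Lemma biactB k g x y : biact k g (x - y) = biact k g x - biact k g y.
Proof. by rewrite addrC -scaleN1r biact_linear scaleN1r addrC. Qed.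

Lemma dbiactM k k' g g' lam : dbiact k g (dbiact k' g' lam) = dbiact (k * k') (g * g') lam.
Proof. by apply/lfunP=> x; rewrite !dbiactE biactM. Qed.

Lemma inLV h : inL E h^-1%g = (inL E h)^-1%g.
Proof. by rewrite /inL morphV ?inE. Qed.

Lemma inUV u : inU u^-1%g = (inU u)^-1%g.
Proof. by rewrite /inU morphV ?inE. Qed.

Lemma LpartV g : Lpart g^-1%g = (Lpart g)^-1%g.
Proof. by apply: (mulgI (Lpart g)); rewrite -LpartM !mulgV. Qed.

Lemma LpartJ g k : Lpart (g ^ k)%g = (Lpart g ^ Lpart k)%g.
Proof. by rewrite !conjgE !LpartM LpartV. Qed.

Lemma Adst_dbiact r lam : Adst E r lam = dbiact (inL E r) (inL E r) lam.
Proof. by rewrite /Adst /dbiact inLV. Qed.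

Lemma Jconj_biact r x : Jconj E r^-1%g x = biact (inL E r) (inL E r) x.
Proof. by rewrite /biact -inLV lmul_inL rmul_inL /Jconj invgK lractC. Qed.

Lemma eq_inU g : Lpart g = 1%g -> g = inU (OnePlus E (Jpart g)).
Proof. by move=> g1; rewrite -[LHS]eltE g1 /elt /inL morph1 mul1g. Qed.

(** Membership of k in U is recorded as the triviality of its L-part, which
    [LpartM] propagates through products. *)
Lemma GUP lam mu :
  reflect (exists k g, Lpart k = 1%g /\ mu = dbiact k g lam) (mu \in GU E lam).
Proof.
apply: (iffP imset2P) => [[g u _ _ ->] | [k [g [k1 ->]]]].
  by exists (inU u)^-1%g, g; rewrite LpartV Lpart_inU invg1 /dbiact invgK.
exists g (OnePlus E (Jpart k))^-1%g; rewrite ?inE //.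
by rewrite inUV -eq_inU.
Qed.

(** U is normal in G: writing k = r u, the part u is absorbed by the orbit and
    any g may be traded for r on the other side. *)
Lemma GU_dbiact k g lam : GU E (dbiact k g lam) = [set Adst E (Lpart k) mu | mu in GU E lam].
Proof.
apply/setP=> mu; apply/GUP/imsetP=> [[k' [g' [k1 ->]]] | [mu' /GUP[k' [g' [k1 ->]] ->]]].
  exists (dbiact ((inL E (Lpart k))^-1 * (k' * k)) ((inL E (Lpart k))^-1 * (g' * g)) lam)%g.
    apply/GUP; do 2!eexists; split; last by [].
    by rewrite !LpartM k1 mul1g LpartV Lpart_inL mulVg.
  by rewrite Adst_dbiact !dbiactM !mulKVg.
exists (inL E (Lpart k) * k' * k^-1)%g, (inL E (Lpart k) * g' * g^-1)%g.
by rewrite Adst_dbiact !dbiactM !mulgKV !LpartM k1 LpartV Lpart_inL mulg1 mulgV.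
Qed.

Lemma Adst_inj r : injective (Adst E r).
Proof. by apply: (@can_inj _ _ _ (Adst E r^-1%g)) => mu; rewrite -AdstM mulVg Adst1. Qed.

Lemma GU_eq lam mu : mu \in GU E lam -> GU E mu = GU E lam.
Proof.
case/GUP=> k [g [k1 ->]]; rewrite GU_dbiact k1 -[RHS]imset_id.
by apply: eq_imset => nu; rewrite Adst1.
Qed.

Lemma mem_Hstab_dbiact h k g lam :
  (h \in Hstab E (GU E (dbiact k g lam))) = (h ^ Lpart k \in Hstab E (GU E lam))%g.
Proof.
have AdJ mu : Adst E h (Adst E (Lpart k) mu) = Adst E (Lpart k) (Adst E (h ^ Lpart k)%g mu).
  by rewrite -!AdstM -conjgC.
rewrite GU_dbiact !inE; apply/forall_inP/forall_inP=> fix_h mu GUmu.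
  by rewrite -(inj_eq (@Adst_inj (Lpart k))) -AdJ fix_h // imset_f.
by have /imsetP[nu GUnu ->] := GUmu; rewrite AdJ (inj_eq (@Adst_inj (Lpart k))) fix_h.
Qed.

(** The functionals vanishing at x form a subspace of J*, so it contains the sum
    of the spans as soon as it contains the orbits that generate it. *)
Lemma JprimeP h x :
  reflect (forall lam, h \in Hstab E (GU E lam) -> lam x = 0) (x \in Jprime E h).
Proof.
have evL : linear (fun mu : 'Hom(J, F^o) => mu x).
  by move=> a mu nu; rewrite add_lfunE scale_lfunE.
rewrite inE; apply: (iffP forallP) => [x0 lam Hh | x0 mu].
  apply/eqP; have /implyP := x0 lam; apply.
  have: (<<enum (GU E lam)>> <= fixed_span E h)%VS by apply: (sumv_sup lam).
  by move/subvP; apply; apply: memv_span; rewrite mem_enum GU_refl.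
apply/implyP=> span_mu; pose ev := linfun (fun mu : 'Hom(J, F^o) => mu x : F^o).
have evE : ev =1 fun mu => mu x by apply: linfunE.
suffices /subvP/(_ mu span_mu) : (fixed_span E h <= lker ev)%VS.
  by rewrite memv_ker evE.
apply/subv_sumP=> lam Hh; apply/span_subvP=> nu enum_nu.
have GUnu : (nu : dJ) \in GU E lam by rewrite -mem_enum.
by rewrite memv_ker evE x0 ?(GU_eq GUnu).
Qed.

Lemma JprimeD h x y : x \in Jprime E h -> y \in Jprime E h -> x + y \in Jprime E h.
Proof.
by move=> /JprimeP x0 /JprimeP y0; apply/JprimeP=> lam Hh; rewrite linearD /= x0 ?y0 ?addr0.
Qed.

Lemma JprimeZ h a x : x \in Jprime E h -> a *: x \in Jprime E h.
Proof. by move=> /JprimeP x0; apply/JprimeP=> lam Hh; rewrite linearZ /= x0 ?scaler0. Qed.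

Lemma Jprime0 h : 0 \in Jprime E h.
Proof. by apply/JprimeP=> lam _; rewrite linear0. Qed.

Lemma JprimeN h x : x \in Jprime E h -> - x \in Jprime E h.
Proof. by rewrite -scaleN1r; apply: JprimeZ. Qed.

(** The action of (k, g) matches the orbits fixed by h^k with those fixed by h.
    For k in U this is the stability of J'_h under U and G. *)
Lemma Jprime_biact h k g d : d \in Jprime E h -> biact k g d \in Jprime E (h ^ Lpart k)%g.
Proof.
by move=> /JprimeP d0; apply/JprimeP=> lam Hh; rewrite -dbiactE d0 // mem_Hstab_dbiact.
Qed.

Lemma Jprime_biactE h k g d : (biact k g d \in Jprime E (h ^ Lpart k)%g) = (d \in Jprime E h).
Proof.
apply/idP/idP; last exact: Jprime_biact.
by move/(Jprime_biact k^-1%g g^-1%g); rewrite biactK LpartV conjgK.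
Qed.

(** Ad_h is trivial modulo J'_h: the functionals that cut out J'_h are fixed by
    Ad*_h. *)
Lemma JconjV_Jprime h x : Jconj E h^-1%g x - x \in Jprime E h.
Proof.
apply/JprimeP=> lam Hh; rewrite linearB /= -AdstE.
by move: Hh; rewrite inE => /forall_inP/(_ _ (GU_refl _ _))/eqP->; rewrite subrr.
Qed.

(** Conjugation in G is linear modulo J'. With h', x' the two parts of y^k and b
    the J-part of k, comparing the J-parts of y k = k y^k gives
      x k = k x' + r (d + d x'),  where d = Ad_{h'}^-1 b - b,
    and d lies in J'_{h'} by [JconjV_Jprime]. *)
Lemma JpartJ (y k : G) :
  Jpart (y ^ k)%g - biact k k (Jpart y) \in Jprime E (Lpart (y ^ k)%g).
Proof.
set h' := Lpart (y ^ k)%g; set x' := Jpart (y ^ k)%g; set x := Jpart y.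
pose b := Jpart k; pose r := Lpart k.
have eqJ : Jconj E r^-1%g x + b + amul E (Jconj E r^-1%g x) b =
  Jconj E h'^-1%g b + x' + amul E (Jconj E h'^-1%g b) x'.
  by have := congr1 (@Jpart _ _ _ E) (conjgC y k); rewrite (JpartM y k) (JpartM k).
(* The rest is a formal computation in h', x' and d, and d is made opaque so
   that it counts as one term when sums are rearranged. *)
clearbody h' x'; pose d := Jconj E h'^-1%g b - b.
have d0 : d \in Jprime E h' by apply: JconjV_Jprime.
have cE : Jconj E h'^-1%g b = b + d by rewrite addrC subrK.
clearbody d.
have key : rmul x k = lmul k x' + Defs.lact E r (d + amul E d x').
  rewrite /rmul /lmul -/b -/r.
  have {}eqJ : Jconj E r^-1%g x + amul E (Jconj E r^-1%g x) b =
      x' + amul E b x' + (d + amul E d x').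
    rewrite cE amulDl in eqJ; apply: (addrI b); rewrite addrA [b + _]addrC eqJ -!addrA.
    by congr (_ + _); rewrite addrCA; congr (_ + _); rewrite addrCA.
  have xr : Defs.ract E x r = Defs.lact E r (Jconj E r^-1%g x).
    by rewrite /Jconj invgK -lractC -Defs.lactM mulgV Defs.lact1.
  by rewrite xr -lact_amul -!lactD eqJ.
have -> : biact k k x = x' + lmul k^-1%g (Defs.lact E r (d + amul E d x')).
  by rewrite /biact key -[lmul k x' in LHS]scale1r lmul_linear -lmulM mulVg lmul1 scale1r.
rewrite opprD addNKr -scaleN1r; apply: JprimeZ.
have /(Jprime_biact (inL E r^-1%g * k)%g (inU (OnePlus E x'))) := d0.
rewrite LpartM Lpart_inL mulVg conjg1 /biact invMg -inLV invgK lmulM lmul_inL.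
by rewrite /rmul Lpart_inU Jpart_inU Defs.ract1.
Qed.

End Algebra.

Arguments biact {F J L E} (k g)%_g x%_R.
Arguments dbiact {F J L E} (k g)%_g lam%_R.
Arguments Jprime_biact {F J L E} h (k g)%_g [d].
Arguments Jprime_biactE {F J L E} h (k g)%_g d.

(** * Superclasses as the fibres of a map to L-orbits of labels *)

Section Classes.

Variables (F : finFieldType) (J : vectType F) (L : finGroupType).
Variable E : alg_ext J L.

Local Notation fJ := (finvect_type J).
Local Notation G := (algG E).
Local Notation dJ := (dual J).

Implicit Types (x y z d : fJ) (h r : L) (g k : G) (lam mu : dJ).

Lemma dual_separates x : (forall lam : dJ, lam x = 0) -> x = 0.
Proof.
move=> x0; rewrite [LHS](coord_vbasis (memvf (x : J))) big1 // => i _.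
have := x0 (linfun (coord (vbasis {:J}) i : J -> F^o)).
by rewrite linfunE => [->|]; [rewrite scale0r | apply: linearP].
Qed.

Lemma Jprime_subC h x y : (x - y \in Jprime E h) = (y - x \in Jprime E h).
Proof. by apply/idP/idP=> /JprimeN; rewrite opprB. Qed.

Lemma Jproj_eq h x y : (Jproj E h x == Jproj E h y) = (x - y \in Jprime E h).
Proof.
apply/eqP/idP=> [eqxy | Jxy].
  have: x \in Jproj E h x by apply/imsetP; exists 0; rewrite ?Jprime0 ?addr0.
  by rewrite eqxy => /imsetP[d Jd ->]; rewrite addrC addKr.
apply/setP=> z; apply/imsetP/imsetP=> [] [d Jd ->].
  by exists (x - y + d); rewrite 1?JprimeD // addrA [y + _]addrC subrK.
by exists (y - x + d); rewrite 1?JprimeD // 1?Jprime_subC // addrA [x + _]addrC subrK.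
Qed.

Lemma biact_Jproj k g h x :
  [set biact k g y | y in Jproj E h x] = Jproj E (h ^ Lpart k)%g (biact k g x).
Proof.
apply/setP=> y; apply/imsetP/imsetP=> [[_ /imsetP[d Jd ->] ->] | [d Jd ->]].
  by exists (biact k g d); rewrite ?Jprime_biact // biactD.
exists (x + biact k^-1 g^-1 d); last by rewrite biactD biactKV.
by apply/imsetP; exists (biact k^-1 g^-1 d); rewrite // -(Jprime_biactE _ k g) biactKV.
Qed.

Lemma UGP h x C :
  reflect (exists k g, Lpart k = 1%g /\ C = Jproj E h (biact k g x))
          (C \in UG E (Jproj E h x)).
Proof.
apply: (iffP imset2P) => [[u g _ _ ->] | [k [g [k1 ->]]]].
  have Lu : Lpart (inU u)^-1%g = 1%g by rewrite LpartV Lpart_inU invg1.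
  exists (inU u)^-1%g, g; split=> //; rewrite -{2}[h]conjg1 -Lu -biact_Jproj.
  by apply: eq_imset => y; rewrite /biact invgK.
exists (OnePlus E (Jpart k))^-1%g g; rewrite ?inE //.
rewrite -{1}[h]conjg1 -k1 -biact_Jproj; apply: eq_imset => y.
by rewrite /biact inUV -eq_inU.
Qed.

(** The relation that the superclasses are going to be the classes of: the L-part
    of k conjugates h, its U-part and g act on the coset of J'. *)
Definition superclass_rel (y z : G) : Prop := exists k g,
  Lpart z = (Lpart y ^ Lpart k)%g /\ Jpart z - biact k g (Jpart y) \in Jprime E (Lpart z).

(** The element of B'_0 that y gives rise to; y and z lie in the same superclass
    when their labels lie in the same L-orbit. *)
Definition class_label (y : G) := (Lpart y, UG E (Jproj E (Lpart y) (Jpart y))).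
Definition label_orbit (y : G) := [set B_conj E r (class_label y) | r : L].

Lemma superclass_rel_refl (y : G) : superclass_rel y y.
Proof. by exists 1%g, 1%g; rewrite biact1 Lpart1 conjg1 subrr Jprime0. Qed.

Lemma superclass_rel_sym (y z : G) : superclass_rel y z -> superclass_rel z y.
Proof.
case=> k [g [hE Jz]]; exists k^-1%g, g^-1%g; split; first by rewrite hE LpartV conjgK.
by rewrite Jprime_subC -(Jprime_biactE _ k g) -hE biactB biactKV.
Qed.

Lemma superclass_rel_trans (x y z : G) :
  superclass_rel x y -> superclass_rel y z -> superclass_rel x z.
Proof.
case=> k [g [yE Jy]] [k' [g' [zE Jz]]]; exists (k * k')%g, (g * g')%g.
rewrite LpartM conjgM -yE; split=> //; rewrite -biactM.
have: biact k' g' (Jpart y - biact k g (Jpart x)) \in Jprime E (Lpart z).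
  by rewrite zE Jprime_biact.
by move/(JprimeD Jz); rewrite biactB addrA subrK.
Qed.

Lemma eq_UG h x y : reflect (exists k g, Lpart k = 1%g /\ y - biact k g x \in Jprime E h)
  (UG E (Jproj E h x) == UG E (Jproj E h y)).
Proof.
apply: (iffP eqP) => [eqxy | [k [g [k1 Jxy]]]].
  have: Jproj E h y \in UG E (Jproj E h x).
    by rewrite eqxy; apply/UGP; exists 1%g, 1%g; rewrite biact1.
  by case/UGP=> k [g [k1 /eqP]]; rewrite Jproj_eq; exists k, g.
have yE: Jproj E h y = Jproj E h (biact k g x) by apply/eqP; rewrite Jproj_eq.
have {}yE : Jproj E h y = [set biact k g z | z in Jproj E h x] by rewrite biact_Jproj k1 conjg1.
apply/setP=> C; apply/UGP/UGP=> [] [k' [g' [k1' ->]]]; last first.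
  exists (k * k')%g, (g * g')%g; rewrite LpartM k1 k1' mulg1; split=> //.
  apply/eqP; rewrite Jproj_eq -biactM -biactB -{1}[h]conjg1 -k1' Jprime_biact //.
exists (k^-1 * k')%g, (g^-1 * g')%g; rewrite LpartM LpartV k1 k1' invg1 mulg1; split=> //.
apply/eqP; rewrite Jproj_eq -biactM -biactB -{1}[h]conjg1 -k1' Jprime_biact //.
by rewrite Jprime_subC -[h]conjg1 -k1 -(Jprime_biactE _ k g) biactB biactKV k1 !conjg1.
Qed.

Lemma B_conj_class_label r (y : G) :
  B_conj E r (class_label y) = class_label (elt E (Lpart y ^ r^-1)%g (Jconj E r (Jpart y))).
Proof.
rewrite /B_conj /class_label Lpart_elt Jpart_elt /=; congr pair.
pose k0 := inL E r^-1%g; have k0E : Lpart k0 = r^-1%g by rewrite Lpart_inL.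
have JE z : Jconj E r z = biact k0 k0 z by rewrite -Jconj_biact invgK.
have JprE h x (C := Jproj E h x) :
    [set Jconj E r z | z in C] = Jproj E (h ^ r^-1)%g (biact k0 k0 x).
  by rewrite -k0E -biact_Jproj; apply: eq_imset.
apply/setP=> C; apply/imsetP/UGP=> [[_ /UGP[k [g [k1 ->]]] ->] | [k [g [k1 ->]]]].
  exists (k0^-1 * (k * k0))%g, (k0^-1 * (g * k0))%g.
  by rewrite JprE JE !biactM !mulKVg !LpartM LpartV k1 mul1g mulVg.
exists (Jproj E (Lpart y) (biact (k0 * k * k0^-1) (k0 * g * k0^-1) (Jpart y))).
  apply/UGP; do 2!eexists; split; last by [].
  by rewrite !LpartM k1 LpartV mulg1 mulgV.
by rewrite JprE JE !biactM !mulgKV.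
Qed.

Lemma class_labelE (y z : G) : class_label y = class_label z <->
  Lpart y = Lpart z /\ UG E (Jproj E (Lpart y) (Jpart y)) = UG E (Jproj E (Lpart y) (Jpart z)).
Proof.
rewrite /class_label; split=> [[yz]| [yz ->]]; last by rewrite yz.
by rewrite {2}yz => ->; rewrite yz.
Qed.

(** Conjugating a label by r is the action of the pair (r^-1, r^-1) on G, and
    each k in G is such an r^-1 times an element of U. *)
Lemma mem_label_orbit (y z : G) : class_label z \in label_orbit y <-> superclass_rel y z.
Proof.
split=> [/imsetP[r _] | [k [g [hE Jz]]]].
  rewrite B_conj_class_label => /esym/class_labelE; rewrite Lpart_elt Jpart_elt => - [hE /eqP].
  case/eq_UG=> k [g [k1 Jz]]; exists (inL E r^-1%g * k)%g, (inL E r^-1%g * g)%g.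
  by rewrite LpartM k1 mulg1 Lpart_inL -biactM -Jconj_biact invgK -hE.
apply/imsetP; exists (Lpart k)^-1%g; rewrite // B_conj_class_label; apply/esym/class_labelE.
rewrite Lpart_elt Jpart_elt invgK -hE; split=> //; apply/eqP/eq_UG.
exists ((inL E (Lpart k))^-1 * k)%g, ((inL E (Lpart k))^-1 * g)%g.
by rewrite LpartM LpartV Lpart_inL mulVg Jconj_biact biactM !mulKVg.
Qed.

Lemma label_orbit_eq (y z : G) :
  (label_orbit y == label_orbit z) = (class_label z \in label_orbit y).
Proof.
have orbP b w : b \in label_orbit w -> exists v : G, b = class_label v.
  by case/imsetP=> r _ ->; rewrite B_conj_class_label; eexists.
apply/eqP/idP=> [-> | /mem_label_orbit yz]; first exact/mem_label_orbit/superclass_rel_refl.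
apply/setP=> b; apply/idP/idP=> bP; have [v vE] := orbP _ _ bP;
  move: bP; rewrite vE => /mem_label_orbit.
  by move/(superclass_rel_trans (superclass_rel_sym yz)) => ?; apply/mem_label_orbit.
by move/(superclass_rel_trans yz) => ?; apply/mem_label_orbit.
Qed.

Lemma mem_B0 b : b \in B0 E -> exists y : G, b = class_label y.
Proof.
rewrite inE => /existsP[x /eqP bE]; exists (elt E b.1 x).
by rewrite /class_label Lpart_elt Jpart_elt -bE; case: b {bE}.
Qed.

Lemma B_orbitsP (beta : {set L * {set {set fJ}}}) :
  reflect (exists y : G, beta = label_orbit y) (beta \in B_orbits E).
Proof.
apply: (iffP imsetP) => [[b /mem_B0[y ->] ->] | [y ->]]; exists y || exists (class_label y) => //.
by rewrite inE; apply/existsP; exists (Jpart y).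
Qed.

Lemma class_label_conjL (y : G) r : class_label (y ^ inL E r)%g = B_conj E r^-1%g (class_label y).
Proof.
rewrite B_conj_class_label invgK; congr class_label; rewrite -[LHS]eltE LpartJ Lpart_inL; congr elt.
rewrite conjgE (JpartM _ (y * _)%g) (JpartM y) -!inLV !Jpart_inL Lpart_inL.
by rewrite Jconj0 amul0r amul0l !addr0 add0r.
Qed.

(** Labels are equivariant under conjugation by L ([class_label_conjL]), so a union of
    L-conjugates is the preimage of an L-orbit of labels. *)
Lemma mem_sclass (y z : G) :
  (z \in sclass E (class_label y)) = (class_label z \in label_orbit y).
Proof.
have sclP : reflect (exists p, class_label (z ^ inL E p)%g = class_label y)
                    (z \in sclass E (class_label y)).
  apply: (iffP bigcupP) => [[p _] | [p eqyz]].
    rewrite mem_conjgV => /imsetP[x]; rewrite inE => xy zE; exists p.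
    rewrite zE; apply/class_labelE; rewrite Lpart_elt Jpart_elt; split=> //.
    case/UGP: xy => k [g [k1 /eqP]]; rewrite Jproj_eq => Jx.
    by apply/esym/eqP/eq_UG; exists k, g.
  exists p => //; rewrite mem_conjgV; apply/imsetP; exists (Jpart (z ^ inL E p)%g).
    case/class_labelE: eqyz => hE UGE; rewrite inE /= -hE -UGE.
    by apply/UGP; exists 1%g, 1%g; rewrite biact1.
  by case/class_labelE: eqyz => /= <- _; rewrite eltE.
apply/sclP/idP=> [[p pE] | ].
  rewrite -label_orbit_eq eq_sym label_orbit_eq -pE class_label_conjL.
  by apply/imsetP; exists p^-1%g.
rewrite -label_orbit_eq eq_sym label_orbit_eq => /imsetP[r _ yE]; exists r^-1%g.
by rewrite class_label_conjL invgK.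
Qed.

Variable repB : {set L * {set {set fJ}}} -> L * {set {set fJ}}.
Hypothesis hrepB : forall beta, beta \in B_orbits E -> repB beta \in beta.

Lemma sclass_repB (y : G) :
  sclass E (repB (label_orbit y)) = [set z | label_orbit y == label_orbit z].
Proof.
have: label_orbit y \in B_orbits E by apply/B_orbitsP; exists y.
move/hrepB => /[dup] by_; case/imsetP=> r _; rewrite B_conj_class_label.
set y' := elt _ _ _ => y'E; rewrite y'E in by_ *; apply/setP=> z; rewrite mem_sclass inE.
by rewrite -label_orbit_eq in by_; rewrite (eqP by_) label_orbit_eq.
Qed.

Local Notation K := [seq sclass E (repB beta) | beta in B_orbits E].

(** The superclasses are the fibres of [label_orbit]. *)
Lemma sclass_partition : uniq K /\ partition [set:: K] [set: G].
Proof.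
split.
  rewrite map_inj_in_uniq ?enum_uniq // => b c; rewrite !mem_enum.
  case/B_orbitsP=> y -> /B_orbitsP[z ->]; rewrite !sclass_repB => /setP/(_ z).
  by rewrite !inE eqxx => /eqP.
suffices ->: [set:: K] = preim_partition label_orbit [set: G] by apply: preim_partitionP.
apply/setP=> X; rewrite inE; apply/imageP/imsetP=> [[_ /B_orbitsP[y ->] ->] | [y _ ->]].
  by exists y => //; rewrite sclass_repB; apply/setP=> z; rewrite !inE.
exists (label_orbit y); first by apply/B_orbitsP; exists y.
by rewrite sclass_repB; apply/setP=> z; rewrite !inE.
Qed.

(** Every functional is fixed by Ad*_1, so J'_1 = 0 and the superclass of 1 is
    the G x G orbit of 0. *)
Lemma sclass1 : ([set 1%g] : {set G}) \in K.
Proof.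
apply/imageP; exists (label_orbit 1%g); first by apply/B_orbitsP; exists 1%g.
rewrite sclass_repB; apply/setP=> z; rewrite !inE label_orbit_eq.
apply/eqP/idP=> [-> | /mem_label_orbit].
  exact/mem_label_orbit/superclass_rel_refl.
have J1 x : x \in Jprime E 1%g -> x = 0.
  by move=> /JprimeP x0; apply: dual_separates => lam; apply: x0; apply: group1.
case=> k [g [hE]]; rewrite Lpart1 conj1g in hE.
have biact0 : biact k g 0 = 0 by have := biactB k g 0 0; rewrite !subrr.
rewrite hE (Jpart1 E) biact0 subr0 => /J1 J0; rewrite -[z]eltE hE J0.
exact: (eltE (1%g : G)).
Qed.

End Classes.

(** * The closed formula for the supercharacters *)

Section Eps.

Variables (F : finFieldType) (eps : F -> algC).
Hypothesis eps_neq0 : forall t, eps t != 0.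
Hypothesis epsD : forall s t, eps (s + t) = eps s * eps t.
Hypothesis eps_nontrivial : exists t, eps t != 1.

Lemma eps0 : eps 0 = 1.
Proof. by apply: (mulfI (eps_neq0 0)); rewrite mulr1 -epsD addr0. Qed.

Lemma epsMn t n : eps (t *+ n) = eps t ^+ n.
Proof. by elim: n => [|n IHn]; rewrite ?eps0 // mulrS epsD IHn exprS. Qed.

(** The values of eps are roots of unity, as F has positive characteristic. *)
Lemma epsN t : eps (- t) = (eps t)^*.
Proof.
have [p p_pr pF] := finPcharP F.
have: eps t ^+ p = 1 by rewrite -epsMn -mulr_natr (pcharf0 pF) mulr0 eps0.
move/(congr1 Num.norm); rewrite normrX normr1 => /eqP.
rewrite pexpr_eq1 ?prime_gt0 // => /eqP norm1.
apply: (mulfI (eps_neq0 t)); rewrite -epsD subrr eps0.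
by rewrite -normCK norm1 expr1n.
Qed.

(** Translation by v multiplies the sum by eps (f v). *)
Lemma sum_eps_eq0 (V : finZmodType) (f : V -> F) v :
    (forall x, f (v + x) = f v + f x) -> eps (f v) != 1 ->
  \sum_x eps (f x) = 0.
Proof.
move=> fD fv1; set S := \sum_x _.
have : S = eps (f v) * S.
  rewrite {1}/S (reindex_inj (addrI v)) /= mulr_sumr.
  by apply: eq_bigr => x _; rewrite fD epsD.
move/eqP; rewrite -subr_eq0 -{1}[S]mul1r -mulrBl mulf_eq0 subr_eq0 eq_sym.
by rewrite (negPf fv1) => /eqP.
Qed.

(** A nonzero value of f may lie in the kernel of eps; rescaling x makes f take
    every value in F, in particular one where eps is not 1. *)
Lemma eps_scale (V : lmodType F) (f : V -> F) x :
  (forall a z, f (a *: z) = a * f z) -> f x != 0 -> exists a, eps (f (a *: x)) != 1.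
Proof.
move=> fZ fx0; have [t t1] := eps_nontrivial; exists (t / f x).
by rewrite fZ divfK.
Qed.

Variables (J : vectType F) (L : finGroupType) (E : alg_ext J L).

Local Notation fJ := (finvect_type J).
Local Notation G := (algG E).
Local Notation dJ := (dual J).

Implicit Types (x z d : fJ) (h r : L) (g k y : G) (lam mu : dJ).

Lemma sum_eps_lfun lam : \sum_(x : fJ) eps (lam x) = #|{: fJ}|%:R *+ (lam == 0).
Proof.
case: eqP => [-> | /eqP lam0].
  by under eq_bigr do rewrite zero_lfunE eps0; rewrite sumr_const.
have [x lamx] : exists x, lam x != 0.
  apply/existsP; apply: contraR lam0; rewrite negb_exists => /forallP lam0.
  by apply/eqP/lfunP=> x; rewrite zero_lfunE; apply/eqP/negPn.
have lamZ a z : lam (a *: z) = a * lam z :> F by rewrite linearZ.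
have [a av] := eps_scale (f := lam) lamZ lamx.
by apply: (sum_eps_eq0 (v := a *: x)) => // z; rewrite linearD.
Qed.

Lemma sum_eps_dual x : \sum_(lam : dJ) eps (lam x) = #|{: dJ}|%:R *+ (x == 0).
Proof.
case: eqP => [-> | /eqP x0].
  by under eq_bigr do rewrite linear0 eps0; rewrite sumr_const.
have [lam lamx] : exists lam : dJ, lam x != 0.
  apply/existsP; apply: contraR x0; rewrite negb_exists => /forallP x0.
  by apply/eqP/dual_separates => lam; apply/eqP/negPn.
have evZ a (mu : dJ) : (a *: mu) x = a * mu x :> F by rewrite scale_lfunE.
have [a av] := eps_scale (f := fun mu : dJ => mu x) evZ lamx.
by apply: (sum_eps_eq0 (f := fun mu : dJ => mu x) (v := a *: lam)) => // z; rewrite add_lfunE.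
Qed.

Lemma sum_elt (R : nmodType) (Phi : G -> R) :
  \sum_(g : G) Phi g = \sum_(h : L) \sum_(x : fJ) Phi (elt E h x).
Proof.
rewrite pair_big /= (reindex (fun p : L * fJ => elt E p.1 p.2)) //.
exists (fun g => (Lpart g, Jpart g)) => [[h x] _ | g _] /=; last by rewrite eltE.
by rewrite Lpart_elt Jpart_elt.
Qed.

(** For z the J-part of y and u = 1 + a, one has (u mu)(z) = mu(z) + mu(z a), and
    the sum of eps(mu(z a)) over a in J is |J| or 0 according to whether z lies
    in J_right or not. So averaging over U mu encodes the support condition of xi,
    and summing over mu = p lam gives a sum over the whole of G. *)
Lemma sum_xi lam (theta : 'CF(Hstab E (GU E lam))) y :
  (\sum_(p : L) xi eps theta p) y =
  #|{: fJ}|%:R^-1 * \sum_(g : G) theta (Lpart y) * eps (lam (rmul (Jpart y) g)).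
Proof.
rewrite sum_cfunE; under eq_bigr do rewrite cfunE.
have [Hy | Hy] := boolP (Lpart y \in Hstab E (GU E lam)); last first.
  rewrite !big1 ?mulr0 // => p _; rewrite cfun0 ?mul0r ?mul0rn //.
rewrite -mulr_sumr; under eq_bigr do rewrite -mulrnAr.
rewrite -mulr_sumr mulrCA; congr (_ * _); rewrite sum_elt mulr_sumr.
apply: eq_bigr => p _; rewrite dlmulE.
have rmulE x : rmul (Jpart y) (elt E p x) =
    rmul (Jpart y) (inL E p) + amul E (rmul (Jpart y) (inL E p)) x.
  by rewrite /rmul Lpart_elt Jpart_elt Lpart_inL Jpart_inL amul0r addr0.
under eq_bigr do rewrite rmulE linearD epsD.
rewrite -mulr_sumr mulrCA -[LHS]mulr_natr; congr (_ * _).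
rewrite inE Hy /= rmul_inL.
have J0 : (#|{: fJ}|%:R : algC) != 0.
  by rewrite pnatr_eq0 -lt0n; apply/card_gt0P; exists 0.
have -> : (Jpart y \in Jright E lam) =
    [forall x, lam (amul E (Defs.ract E (Jpart y) p) x) == 0].
  apply/JrightP/forallP => y0 x; first by rewrite -amul_lact y0.
  by rewrite -[x](Defs.lact1 E) -(mulgV p) Defs.lactM amul_lact; apply/eqP/y0.
case: forallP => [y0 | /forallP].
  by under eq_bigr do rewrite (eqP (y0 _)) eps0; rewrite sumr_const mulVf.
rewrite negb_forall => /existsP[x yx].
pose f x : F := lam (amul E (Defs.ract E (Jpart y) p) x).
have fZ a z : f (a *: z) = a * f z.
  rewrite /f -[a *: z]addr0 (amul_linear_r E _ a z 0) amul0r addr0.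
  by rewrite linearZ.
have [a av] := eps_scale (f := f) fZ yx.
by rewrite (sum_eps_eq0 (f := f) _ av) ?mulr0 // => z; rewrite /f amulDr linearD.
Qed.

Lemma lamB lam x z : lam (x - z) = lam x - lam z :> F.
Proof. by rewrite linearB. Qed.

Lemma GU_Jprime h lam d : h \in Hstab E (GU E lam) -> d \in Jprime E h -> lam d = 0.
Proof. by move=> Hh /JprimeP; apply. Qed.

(** In the formula for induced characters, a conjugate y^k contributes only when
    its L-part lies in H; then lam vanishes on J', so [JpartJ] lets k^-1 x k
    replace the J-part of y^k, and g is translated by k. *)
Lemma schar_formula lam (theta : 'CF(Hstab E (GU E lam))) y :
  schar eps theta y = #|G0 E lam|%:R^-1 * (#|{: fJ}|%:R^-1 *
    \sum_(k : G) \sum_(g : G) theta (Lpart y ^ Lpart k)%g * eps (lam (biact k g (Jpart y)))).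
Proof.
rewrite /schar (@cfIndE _ [group of [set: G]] (G0_group E lam)) ?subsetT //.
congr (_ * _); rewrite mulr_sumr (eq_bigl xpredT) => [|k]; last by rewrite inE.
apply: eq_bigr => k _; rewrite sum_xi LpartJ; congr (_ * _).
rewrite [RHS](reindex_inj (mulgI k)) /=; apply: eq_bigr => g _.
have [Hy | Hy] := boolP ((Lpart y ^ Lpart k)%g \in Hstab E (GU E lam)); last first.
  by rewrite cfun0 ?mul0r.
congr (_ * eps _); apply/eqP; rewrite -subr_eq0 -lamB; apply/eqP.
apply: (GU_Jprime Hy); have := Jprime_biact _ 1 g (JpartJ y k).
by rewrite (Lpart1 E) conjg1 biactB biactM mulg1 {1}/biact invg1 lmul1 LpartJ.
Qed.

(** The double sum of [schar_formula] absorbs the action of G x G, and where theta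
    does not vanish lam kills the translates of J'. *)
Lemma schar_superclass_rel lam (theta : 'CF(Hstab E (GU E lam))) (y z : G) :
  superclass_rel y z -> schar eps theta y = schar eps theta z.
Proof.
case=> k0 [g0 [zE Jz]]; rewrite !schar_formula; congr (_ * (_ * _)).
rewrite [LHS](reindex_inj (mulgI k0)) /=; apply: eq_bigr => k _.
rewrite [LHS](reindex_inj (mulgI g0)) /=; apply: eq_bigr => g _.
rewrite LpartM conjgM -zE.
have [Hz | Hz] := boolP ((Lpart z ^ Lpart k)%g \in Hstab E (GU E lam)); last first.
  by rewrite cfun0 ?mul0r.
congr (_ * eps _); apply/esym/eqP; rewrite -subr_eq0 -lamB; apply/eqP.
by apply: (GU_Jprime Hz); rewrite -biactM -biactB Jprime_biact.
Qed.

(** Twisting a representation that affords theta by eps^(p lam), which is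
    multiplicative on G0 by [G0_additive], affords xi. *)
Lemma xi_char lam (theta : 'CF(Hstab E (GU E lam))) p :
  theta \is a character -> xi eps theta p \is a character.
Proof.
case/(@char_reprP _ (Hstab_group E (GU E lam)))=> rG thetaE.
pose r (g : G) := eps (dlmul (inL E p) lam (Jpart g)) *: rG (Lpart g).
have r_repr : mx_repr (G0 E lam) r.
  split=> [|g k Gg Gk]; first by rewrite /r Jpart1 Lpart1 linear0 eps0 repr_mx1 scale1r.
  rewrite /r G0_additive // epsD LpartM repr_mxM ?scalemxAl -?scalemxAl ?scalerA.
  - by rewrite -scalemxAr scalerA mulrC.
  - by move: Gg; rewrite mem_G0 => /andP[].
  by move: Gk; rewrite mem_G0 => /andP[].
apply/(@char_reprP _ (G0_group E lam)).
exists (Representation (MxRepresentation r_repr)); apply/cfunP=> g.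
rewrite !cfunE /= mxtraceZ thetaE cfunE mem_G0; case: andP => [[Hg _] | _] //=.
by rewrite Hg mulrC.
Qed.

Lemma schar_char lam (theta : 'CF(Hstab E (GU E lam))) :
  theta \is a character -> schar eps theta \is a character.
Proof.
move=> Ntheta; apply: (@cfInd_char _ [group of [set: G]] (G0_group E lam)).
by apply: rpred_sum => p _; apply: xi_char.
Qed.

End Eps.

(** * S-irreducible characters of a normal subgroup *)

Section RelIrr.

Variable L : finGroupType.
Implicit Types N S : {group L}.

Lemma rel_irrP N S theta :
  reflect (exists i, theta = \sum_(phi <- ('chi[N]_i ^: S)%CF) phi) (theta \in rel_irr N S).
Proof. by apply: (iffP imageP) => [[i _ ->] | [i ->]]; exists i. Qed.

Lemma rel_irr_char N S theta : theta \in rel_irr N S -> theta \is a character.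
Proof.
case/rel_irrP=> i ->; rewrite big_seq; apply: rpred_sum => _ /cfclassP[s _ ->].
by rewrite cfConjg_char ?irr_char.
Qed.

Lemma rel_irr1_neq0 N S theta : theta \in rel_irr N S -> theta 1%g != 0.
Proof.
case/rel_irrP=> i ->; rewrite sum_cfunE big_seq.
rewrite (eq_bigr (fun=> 'chi_i 1%g)) => [|_ /cfclassP[s _ ->]]; last by rewrite cfConjg1.
rewrite -big_seq big_const_seq iter_addr_0 mulrn_eq0 negb_or irr1_neq0 andbT.
by rewrite count_predT size_eq0; have := cfclass_refl S 'chi_i; case: (_ ^: S)%CF.
Qed.

(** Sums over two distinct S-orbits have no irreducible constituent in common. *)
Lemma rel_irr_eq N S theta eta : N <| S ->
  theta \in rel_irr N S -> eta \in rel_irr N S -> '[theta, eta] != 0 -> theta = eta.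
Proof.
move=> nNS /rel_irrP[i ->] /rel_irrP[j ->] dot_neq0.
suffices chi_ij : 'chi_j \in ('chi_i ^: S)%CF.
  apply: perm_big; apply: uniq_perm; rewrite ?cfclass_uniq //; exact: cfclass_transr.
apply: contraR dot_neq0 => not_ij; rewrite cfdot_suml big_seq big1 // => phi chi_phi.
rewrite cfdot_sumr big_seq big1 // => psi chi_psi.
have irr_cls k xi : xi \in ('chi[N]_k ^: S)%CF -> xi \in irr N.
  by case/cfclassP=> s _ ->; rewrite cfConjg_irr ?mem_irr.
have /irrP[a aE] := irr_cls _ _ chi_phi; have /irrP[b bE] := irr_cls _ _ chi_psi.
rewrite aE bE cfdot_irr; case: eqP => // ab; case/negP: not_ij.
by rewrite (cfclass_transr chi_phi) cfclass_sym (cfclass_transr chi_psi) aE bE ab cfclass_refl.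
Qed.

(** Conjugation by r is an isomorphism between N' and N that carries S'-orbits of
    irreducible characters to S-orbits. *)
Lemma rel_irr_conj N S N' S' r theta : N <| S -> N' <| S' ->
    N :=: (N' :^ r^-1)%g -> S :=: (S' :^ r^-1)%g -> theta \in rel_irr N' S' ->
  exists2 eta, eta \in rel_irr N S & forall h, eta h = theta (h ^ r)%g.
Proof.
move=> nNS nNS' NE SE /rel_irrP[i ->].
have isoN : isom N' N (conjgm N' r^-1%g) by rewrite NE conj_isom.
pose C := cfIsom isoN.
have CE phi h : C phi h = phi (h ^ r)%g.
  have [Nh | nNh] := boolP (h \in N); last first.
    rewrite !cfun0 //; apply: contra nNh => Nhr.
    by rewrite NE mem_conjgV.
  rewrite NE mem_conjgV in Nh; rewrite -[h in LHS](conjgK r).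
  exact: (cfIsomE isoN).
have [j jE] : exists j, C 'chi_i = 'chi_j.
  by apply/irrP; rewrite cfIsom_irr mem_irr.
exists (\sum_(phi <- ('chi_j ^: S)%CF) phi); first by apply/rel_irrP; exists j.
have CJ phi s : s \in S' -> C (phi ^ s)%CF = (C phi ^ (s ^ r^-1))%CF.
  move=> Ss; have Ns := subsetP (normal_norm nNS') _ Ss.
  have Ns' : (s ^ r^-1)%g \in 'N(N).
    by apply: (subsetP (normal_norm nNS)); rewrite SE memJ_conjg.
  apply/cfunP=> h; rewrite CE !cfConjgE // CE -!conjgM; congr (phi (h ^ _)%g).
  by rewrite -conjVg conjgE invgK !mulgA mulgKV.
have permC : perm_eq [seq C phi | phi <- ('chi_i ^: S')%CF] ('chi_j ^: S)%CF.
  apply: uniq_perm; rewrite ?cfclass_uniq //.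
    by rewrite map_inj_uniq ?cfclass_uniq //; apply: cfIsom_inj.
  move=> psi; apply/mapP/cfclassP=> [[_ /cfclassP[s Ss ->] ->] | [s Ss ->]].
    by exists (s ^ r^-1)%g; rewrite ?SE ?memJ_conjg // -jE CJ.
  have Ss' : (s ^ r)%g \in S' by rewrite SE mem_conjgV in Ss.
  exists ('chi_i ^ (s ^ r))%CF; first by apply/cfclassP; exists (s ^ r)%g.
  by rewrite CJ // conjgK jE.
by move=> h; rewrite -(perm_big _ permC) big_map !sum_cfunE; apply: eq_bigr.
Qed.

(** An S-invariant function has the same coefficient on all the irreducibles in an
    S-orbit, and its scalar product with their sum is a positive multiple of it. *)
Lemma rel_irr_complete N S (Phi : 'CF(N)) : N <| S ->
    (forall s, s \in S -> (Phi ^ s)%CF = Phi) ->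
  (forall theta, theta \in rel_irr N S -> '[Phi, theta] = 0) -> Phi = 0.
Proof.
move=> nNS PhiS Phi0; rewrite [Phi]cfun_sum_cfdot big1 // => i _.
have := Phi0 _ (image_f _ (_ : i \in Iirr N)) => /(_ isT) /eqP.
rewrite cfdot_sumr big_seq (eq_bigr (fun=> '[Phi, 'chi_i])) => [|_ /cfclassP[s Ss ->]]; last first.
  by rewrite -{1}(PhiS s Ss) cfConjg_iso.
rewrite -big_seq big_const_seq iter_addr_0 mulrn_eq0 count_predT size_eq0.
by have := cfclass_refl S 'chi_i; case: (_ ^: S)%CF => //= ? ? _ /eqP->; rewrite scale0r.
Qed.

End RelIrr.

(** * Counting characters against blocks *)

Section Size.

Variables (gT : finGroupType) (G : {group gT}) (chi : seq 'CF(G)) (K : seq {set gT}).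
Hypotheses (uK : uniq K) (partK : partition [set:: K] G) (orth : pairwise_orthogonal chi).
Hypothesis chiK : forall phi X, phi \in chi -> X \in K -> {in X &, forall x y, phi x = phi y}.
Hypothesis chi_complete : forall f : gT -> algC,
  (forall X, X \in K -> {in X &, forall x y, f x = f y}) ->
  (forall phi, phi \in chi -> \sum_(y in G) f y * (phi y)^* = 0) ->
  {in G, forall y, f y = 0}.

Local Notation n := (size chi).
Local Notation m := (size K).

Lemma row_free_of_inj p q (A : 'M[algC]_(p, q)) :
  (forall v : 'rV_p, v *m A = 0 -> v = 0) -> row_free A.
Proof.
move=> inj; rewrite -kermx_eq0; apply/eqP/row_matrixP=> i; rewrite row0.
by apply: inj; apply/sub_kermxP/row_sub.
Qed.

(** The values of the characters on the blocks form an n x m matrix whose rows are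
    independent by orthogonality. The sums of the conjugate characters over the
    blocks form an m x n matrix whose rows are independent because the characters
    separate the functions constant on the blocks. So n <= m <= n. *)
Lemma size_chi_K : n = m.
Proof.
have [coverK trivK K0] := and3P partK.
have eqK (j l : 'I_m) y : y \in nth set0 K j -> y \in nth set0 K l -> j = l.
  move=> yj yl; apply/val_inj/eqP; rewrite -(nth_uniq set0 _ _ uK) ?ltn_ord //.
  rewrite -(def_pblock trivK _ yj) ?inE ?mem_nth //.
  by rewrite -(def_pblock trivK _ yl) ?inE ?mem_nth.
have exK y : y \in G -> exists j : 'I_m, y \in nth set0 K j.
  rewrite -(eqP coverK) => /bigcupP[X]; rewrite inE => KX Xy.
  have Xm : (index X K < m)%N by rewrite index_mem.
  by exists (Ordinal Xm); rewrite /= nth_index.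
apply/eqP; rewrite eqn_leq; apply/andP; split.
  pose M := \matrix_(i < n, j < m) chi`_i (repr (nth set0 K j)).
  suffices /eqP <- : row_free M by apply: rank_leq_col.
  apply: row_free_of_inj => v vM.
  have /freeP free_chi : free (in_tuple chi) by apply: orthogonal_free.
  apply/rowP=> i; rewrite mxE; apply: (free_chi (fun i => v 0 i)) => {i}.
  apply/cfun_inP=> y Gy; rewrite sum_cfunE cfunE.
  have [j yj] := exK y Gy; have /rowP/(_ j) := vM; rewrite !mxE => vMj; rewrite -[RHS]vMj.
  apply: eq_bigr => i _; rewrite !mxE cfunE; congr (_ * _).
  by apply: chiK (yj) _; rewrite ?mem_nth //; apply: mem_repr yj.
pose N := \matrix_(j < m, i < n) \sum_(y in nth set0 K j) (chi`_i y)^*.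
suffices /eqP <- : row_free N by apply: rank_leq_col.
apply: row_free_of_inj => v vN.
(* The function on G that takes the value v_j on the j-th block. *)
pose f y : algC := \sum_j v 0 j *+ (y \in nth set0 K j).
have fE (j : 'I_m) y : y \in nth set0 K j -> f y = v 0 j.
  move=> yj; rewrite /f (bigD1 j) //= yj big1 ?addr0 // => l nlj.
  by case: (boolP (y \in nth set0 K l)) => // yl; rewrite (eqK _ _ _ yl yj) eqxx in nlj.
have f0 : {in G, forall y, f y = 0}.
  apply: chi_complete => [X KX y z Xy Xz | phi chi_phi].
    have Xm : (index X K < m)%N by rewrite index_mem.
    by rewrite !(fE (Ordinal Xm)) //= nth_index.
  have im : (index phi chi < n)%N by rewrite index_mem.
  have /rowP/(_ (Ordinal im)) := vN; rewrite !mxE => vNi; rewrite -[RHS]vNi.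
  transitivity (\sum_(y in G) \sum_j (v 0 j * (phi y)^*) *+ (y \in nth set0 K j)).
    by apply: eq_bigr => y _; rewrite mulr_suml; apply: eq_bigr => j _; rewrite mulrnAl.
  rewrite exchange_big; apply: eq_bigr => j _; rewrite !mxE mulr_sumr.
  rewrite big_mkcond [RHS]big_mkcond; apply: eq_bigr => y _; rewrite nth_index //.
  case: (boolP (y \in nth set0 K j)) => [yj | _]; last by rewrite mulr0n if_same.
  have -> // : y \in G; rewrite -(eqP coverK); apply/bigcupP.
  by exists (nth set0 K j); rewrite ?inE ?mem_nth.
apply/rowP=> j; rewrite mxE.
have : nth set0 K j != set0.
  by apply: contraNneq K0 => <-; rewrite inE mem_nth.
case/set0Pn=> y yj; rewrite -(fE _ _ yj) f0 // -(eqP coverK); apply/bigcupP.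
by exists (nth set0 K j); rewrite ?inE ?mem_nth.
Qed.

End Size.

(** * Fourier analysis of functions constant on superclasses *)

Section Pairing.

Variables (F : finFieldType) (eps : F -> algC).
Hypothesis eps_neq0 : forall t, eps t != 0.
Hypothesis epsD : forall s t, eps (s + t) = eps s * eps t.
Hypothesis eps_nontrivial : exists t, eps t != 1.
Variables (J : vectType F) (L : finGroupType) (E : alg_ext J L).

Local Notation fJ := (finvect_type J).
Local Notation G := (algG E).
Local Notation dJ := (dual J).
Local Notation H lam := (Hstab_group E (GU E lam)).
Local Notation S lam := (Sstab_group E (GU E lam)).

Implicit Types (x z d : fJ) (h r : L) (g k y : G) (lam mu : dJ) (f : G -> algC).

Definition superclass_invariant f := forall y z : G, superclass_rel y z -> f y = f z.

Definition fourier f lam h : algC := \sum_(x : fJ) f (elt E h x) * (eps (lam x))^*.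

(** The scalar product, without its normalization, of f with the function
    theta(h) eps^(lam(x)), arranged along the Fourier coefficients of f. *)
Definition pairing f lam (theta : 'CF(Hstab E (GU E lam))) : algC :=
  \sum_(h : L) fourier f lam h * (theta h)^*.

Lemma pairingE f lam (theta : 'CF(Hstab E (GU E lam))) : pairing f theta =
  \sum_(y : G) f y * (theta (Lpart y) * eps (lam (Jpart y)))^*.
Proof.
rewrite sum_elt; apply: eq_bigr => h _; rewrite mulr_suml; apply: eq_bigr => x _.
by rewrite Lpart_elt Jpart_elt rmorphM -mulrA [_^* * _]mulrC.
Qed.

(** H is the pointwise stabiliser of an orbit of which S is the global one. *)
Lemma Hstab_normal lam : H lam <| S lam.
Proof.
apply/andP; split.
  apply/subsetP=> h; rewrite !inE => /forall_inP fix_h.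
  by apply/eqP; rewrite -[RHS]imset_id; apply: eq_in_imset => mu /fix_h/eqP.
have sub s : s \in S lam -> (H lam :^ s \subset H lam)%g.
  move=> Ss; apply/subsetP=> h; rewrite mem_conjg !inE => /forall_inP fix_h.
  apply/forall_inP=> mu GUmu.
  move: Ss; rewrite inE => /eqP Ss; apply/eqP/(@Adst_inj _ _ _ E s).
  rewrite -AdstM [(s * h)%g]conjgCV AdstM; apply/eqP/fix_h.
  by rewrite -Ss imset_f.
by apply/subsetP=> s Ss; rewrite inE sub.
Qed.

(** Since Ad_h is trivial modulo J'_h, a functional killing J'_h is fixed by Ad*_h;
    its G x U translates kill J'_h too. *)
Lemma Hstab_Jprime h lam : (forall d, d \in Jprime E h -> lam d = 0) -> h \in H lam.
Proof.
move=> lam0; rewrite inE; apply/forall_inP=> _ /GUP[k [g [k1 ->]]].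
apply/eqP/lfunP=> x; rewrite AdstE; apply/eqP; rewrite -subr_eq0 -lamB dbiactE lam0 //.
by rewrite -{2}[h]conjg1 -k1 Jprime_biact ?JconjV_Jprime.
Qed.

Section Invariant.

Variable f : G -> algC.
Hypothesis f_inv : superclass_invariant f.

Lemma invariant_biact k g h x : f (elt E (h ^ Lpart k)%g (biact k g x)) = f (elt E h x).
Proof.
apply/esym/f_inv; exists k, g.
by rewrite !Lpart_elt !Jpart_elt subrr Jprime0.
Qed.

Lemma invariant_Jprime h d x : d \in Jprime E h -> f (elt E h (x + d)) = f (elt E h x).
Proof.
move=> Jd; apply/esym/f_inv; exists 1%g, 1%g.
by rewrite !Lpart_elt !Jpart_elt Lpart1 conjg1 biact1 [x + d]addrC addrK.
Qed.

Lemma fourier_dbiact k g lam h : fourier f (dbiact k g lam) h = fourier f lam (h ^ Lpart k)%g.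
Proof.
rewrite [RHS](reindex_inj (biact_inj (k := k) (g := g))) /=.
by apply: eq_bigr => x _; rewrite invariant_biact dbiactE.
Qed.

(** Translating x by some d in J'_h with eps(lam(d)) != 1 leaves f unchanged and
    rescales the coefficient. *)
Lemma fourier_supp lam h : h \notin H lam -> fourier f lam h = 0.
Proof.
move=> nHh; have [d Jd lamd] : exists2 d, d \in Jprime E h & lam d != 0.
  apply/exists_inP; apply: contraR nHh; rewrite negb_exists_in => /forall_inP lam0.
  by apply: Hstab_Jprime => d /lam0; rewrite negbK => /eqP.
have lamZ a z : lam (a *: z) = a * lam z :> F by rewrite linearZ.
have [a av] := eps_scale eps_nontrivial (f := lam) lamZ lamd.
have : fourier f lam h = fourier f lam h * (eps (lam (a *: d)))^*.
  rewrite {1}/fourier (reindex_inj (addIr (a *: d))) /= mulr_suml.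
  apply: eq_bigr => x _; rewrite invariant_Jprime ?JprimeZ //.
  by rewrite linearD epsD rmorphM mulrA.
move/eqP; rewrite -subr_eq0 -{1}[fourier f lam h]mulr1 -mulrBr mulf_eq0 subr_eq0.
by rewrite [1 == _]eq_sym fmorph_eq1 (negPf av) orbF => /eqP.
Qed.

(** Fourier inversion on J. *)
Lemma fourier_inj : (forall lam h, fourier f lam h = 0) -> forall y, f y = 0.
Proof.
move=> four0 y; rewrite -(eltE y); set h := Lpart y; set x := Jpart y.
(* The coefficients recover the value of f at h(1 + x), up to |J*|. *)
have : \sum_(lam : dJ) fourier f lam h * eps (lam x) = #|{: dJ}|%:R * f (elt E h x).
  under eq_bigr do rewrite mulr_suml.
  rewrite exchange_big (bigD1 x) //= [X in _ + X]big1 => [|z nzx].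
    rewrite addr0 (eq_bigr (fun=> f (elt E h x))) => [|lam _].
      by rewrite sumr_const mulr_natl.
    by rewrite -mulrA -epsN // -epsD addNr eps0 // mulr1.
  under eq_bigr do rewrite -mulrA -epsN // -epsD addrC -lamB.
  by rewrite -mulr_sumr sum_eps_dual // subr_eq0 eq_sym (negPf nzx) mulr0.
rewrite big1 => [|lam _]; last by rewrite four0 mul0r.
move/esym/eqP; rewrite mulf_eq0 pnatr_eq0 => /orP[|/eqP //].
by rewrite -leqn0 leqNgt; case/negP; apply/card_gt0P; exists 0.
Qed.

(** A representative of the conjugate orbit is g lam k^-1 with k of L-part r, and
    [fourier_dbiact] moves the conjugation onto h. *)
Lemma pairing_conj r lam mu (theta : 'CF(Hstab E (GU E lam))) (eta : 'CF(Hstab E (GU E mu))) :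
    GU E mu = [set Adst E r nu | nu in GU E lam] -> (forall h, eta h = theta (h ^ r)%g) ->
  pairing f eta = pairing f theta.
Proof.
move=> GUmu etaE; have := GU_refl E mu; rewrite GUmu => /imsetP[_ /GUP[k [g [k1 ->]]]].
rewrite Adst_dbiact dbiactM => muE; rewrite /pairing [RHS](reindex_inj (conjg_inj r)) /=.
apply: eq_bigr => h _; rewrite etaE {1}muE fourier_dbiact.
by rewrite LpartM Lpart_inL k1 mulg1.
Qed.

(** The coefficients at lam form a class function on H that is invariant under
    S, because S moves lam within its orbit; the hypothesis makes it orthogonal
    to all S-irreducible characters. Outside H, [fourier_supp] applies. *)
Lemma fourier_eq0_of_pairing lam :
  (forall theta, theta \in rel_irr (H lam) (S lam) -> pairing f theta = 0) ->
  forall h, fourier f lam h = 0.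
Proof.
move=> pair0; have fourS h s : s \in S lam -> fourier f lam (h ^ s)%g = fourier f lam h.
  rewrite inE => /eqP Ss; have: Adst E s lam \in GU E lam by rewrite -Ss imset_f ?GU_refl.
  case/GUP=> k [g [k1 lamE]]; have := fourier_dbiact k g lam h.
  by rewrite -lamE Adst_dbiact fourier_dbiact Lpart_inL k1 conjg1.
have Phi_cf : is_class_fun <<H lam>> [ffun h => fourier f lam h].
  rewrite genGid; apply: intro_class_fun => [h s Hh Hs | h]; last exact: fourier_supp.
  by rewrite fourS // (subsetP (normal_sub (Hstab_normal lam))).
pose Phi : 'CF(H lam) := Cfun 0 Phi_cf.
have PhiE h : Phi h = fourier f lam h by rewrite cfunE.
suffices Phi0 : Phi = 0 by move=> h; rewrite -PhiE Phi0 cfunE.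
apply: (rel_irr_complete (Hstab_normal lam)) => [s Ss | theta /pair0 pair_theta].
  apply/cfunP=> h; rewrite cfConjgE ?(subsetP (normal_norm (Hstab_normal lam))) //.
  by rewrite !PhiE fourS ?groupV.
transitivity (#|H lam|%:R^-1 * pairing f theta); last by rewrite pair_theta mulr0.
rewrite cfdotE; congr (_ * _).
rewrite /pairing [LHS]big_mkcond; apply: eq_bigr => h _; rewrite PhiE.
by case: ifPn => // nHh; rewrite fourier_supp ?mul0r.
Qed.

Definition schar_coef lam : algC := #|G0 E lam|%:R^-1 * #|{: fJ}|%:R^-1.

Lemma schar_coef_neq0 lam : schar_coef lam != 0.
Proof.
rewrite mulf_neq0 // invr_eq0 ?(neq0CG (G0_group E lam)) // pnatr_eq0 -lt0n.
by apply/card_gt0P; exists 0.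
Qed.

Lemma schar_coef_conj lam : (schar_coef lam)^* = schar_coef lam.
Proof. by rewrite rmorphM !fmorphV !rmorph_nat. Qed.

(** The term of [schar_formula] for (k, g) is the one for (1, 1) composed with the
    permutation tau k g of G, which preserves f; hence the factor |G|^2. *)
Lemma sum_schar_pairing lam (theta : 'CF(Hstab E (GU E lam))) :
  \sum_(y : G) f y * (schar eps theta y)^* = schar_coef lam * #|{: G}|%:R ^+ 2 * pairing f theta.
Proof.
pose t y := (theta (Lpart y) * eps (lam (Jpart y)))^*.
pose tau k g y := elt E (Lpart y ^ Lpart k)%g (biact k g (Jpart y)).
have tauI k g : injective (tau k g).
  move=> y z eq_tau; have := congr1 (@Lpart _ _ _ E) eq_tau.
  have := congr1 (@Jpart _ _ _ E) eq_tau; rewrite /tau !Jpart_elt !Lpart_elt.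
  by move/biact_inj => eJ /conjg_inj eL; rewrite -(eltE y) eJ eL eltE.
transitivity (schar_coef lam * \sum_k \sum_g \sum_y f y * t (tau k g y)); last first.
  rewrite -mulrA; congr (_ * _); rewrite pairingE expr2 -mulrA mulr_natl -sumr_const.
  apply: eq_bigr => k _; rewrite mulr_natl -sumr_const; apply: eq_bigr => g _.
  rewrite [RHS](reindex_inj (@tauI k g)); apply: eq_bigr => y _.
  by rewrite invariant_biact eltE.
under [in RHS]eq_bigr do rewrite exchange_big.
rewrite exchange_big mulr_sumr; apply: eq_bigr => y _.
rewrite schar_formula // mulrA rmorphM /= -/(schar_coef lam) schar_coef_conj mulrCA; congr (_ * _).
rewrite rmorph_sum mulr_sumr; apply: eq_bigr => k _.
rewrite rmorph_sum mulr_sumr; apply: eq_bigr => g _.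
by rewrite /t /tau Lpart_elt Jpart_elt.
Qed.

End Invariant.

(** Summing over x first leaves only the pairs (k, g) with g lam k^-1 = mu, by
    orthogonality of the additive characters of J. *)
Lemma pairing_schar lam mu (theta : 'CF(Hstab E (GU E lam))) (eta : 'CF(Hstab E (GU E mu))) :
  pairing (schar eps theta) eta != 0 ->
  exists k g, mu = dbiact k g lam /\ \sum_(h : L) theta (h ^ Lpart k)%g * (eta h)^* != 0.
Proof.
move=> pair_neq0.
suffices /existsP[k /existsP[g /andP[/eqP ? ?]]] : [exists k : G, [exists g : G,
   (mu == dbiact k g lam) && (\sum_(h : L) theta (h ^ Lpart k)%g * (eta h)^* != 0)]].
  by exists k, g.
apply: contraR pair_neq0; rewrite negb_exists => /forallP none; apply/eqP.
have -> : pairing (schar eps theta) eta = schar_coef lam * \sum_(k : G) \sum_(g : G)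
    (\sum_(h : L) theta (h ^ Lpart k)%g * (eta h)^*) *
    \sum_(x : fJ) eps ((dbiact k g lam - mu) x).
  have distr k g : (\sum_(h : L) theta (h ^ Lpart k)%g * (eta h)^*) *
       (\sum_(x : fJ) eps ((dbiact k g lam - mu) x)) =
      \sum_(y : G) theta (Lpart y ^ Lpart k)%g * eps (lam (biact k g (Jpart y))) *
        (eta (Lpart y) * eps (mu (Jpart y)))^*.
    rewrite sum_elt mulr_suml; apply: eq_bigr => h _; rewrite mulr_sumr; apply: eq_bigr => x _.
    by rewrite add_lfunE opp_lfunE dbiactE epsD // epsN // rmorphM mulrACA Lpart_elt Jpart_elt.
  under [in RHS]eq_bigr do under eq_bigr do rewrite distr.
  under [in RHS]eq_bigr do rewrite exchange_big.
  rewrite exchange_big mulr_sumr pairingE; apply: eq_bigr => y _.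
  rewrite schar_formula // mulrA -/(schar_coef lam) -mulrA; congr (_ * _).
  by rewrite mulr_suml; apply: eq_bigr => k _; rewrite mulr_suml.
rewrite big1 ?mulr0 // => k _; rewrite big1 // => g _.
have := none k; rewrite negb_exists => /forallP/(_ g); rewrite negb_and negbK.
rewrite sum_eps_lfun // subr_eq0 eq_sym => /orP[/negPf-> | /eqP->].
  by rewrite mulr0n mulr0.
by rewrite mul0r.
Qed.

End Pairing.

(** * Orthogonality, completeness and the supercharacter theory *)

Section Main.

Variables (F : finFieldType) (J : vectType F) (L : finGroupType).
Variable E : alg_ext J L.

Local Notation fJ := (finvect_type J).
Local Notation G := (algG E).
Local Notation dJ := (dual J).
Local Notation H lam := (Hstab_group E (GU E lam)).
Local Notation S lam := (Sstab_group E (GU E lam)).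
Local Notation Apair := (Apair E).

Implicit Types (a b c : Apair) (lam mu : dJ) (h r : L).

Lemma A_conjP r a b :
  reflect (GU E (tag b) = [set Adst E r mu | mu in GU E (tag a)] /\
           forall h, tagged b h = tagged a (h ^ r)%g) (A_conj r a b).
Proof.
by apply: (iffP andP) => - [/eqP GUE HE]; split=> //; [move=> h; apply/eqP/(forallP HE)
  | apply/forallP=> h; apply/eqP].
Qed.

Lemma A_conjM r s a b c : A_conj r a b -> A_conj s b c -> A_conj (s * r)%g a c.
Proof.
move=> /A_conjP[bE tbE] /A_conjP[cE tcE]; apply/A_conjP; split=> [|h].
  by rewrite cE bE -imset_comp; apply: eq_imset => mu; rewrite /= AdstM.
by rewrite tcE tbE conjgM.
Qed.

Lemma A_conjV r a b : A_conj r a b -> A_conj r^-1%g b a.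
Proof.
move=> /A_conjP[bE tbE]; apply/A_conjP; split=> [|h]; last by rewrite tbE conjgKV.
rewrite bE -imset_comp -[LHS]imset_id; apply: eq_imset => mu /=.
by rewrite -AdstM mulVg Adst1.
Qed.

Lemma A0P (T : {set dJ}) a : reflect (tag a \in T /\ tagged a \in rel_irr (H (tag a)) (S (tag a)))
  (a \in A0_seq E T).
Proof.
apply: (iffP allpairsPdep) => [[lam [theta [Tlam Rtheta ->]]] | [Ta Ra]].
  by rewrite mem_enum in Tlam.
by exists (tag a), (tagged a); rewrite mem_enum; split=> //; case: a {Ta Ra}.
Qed.

Lemma Hstab_dbiact lam (k g : G) :
  Hstab E (GU E (dbiact k g lam)) = (Hstab E (GU E lam) :^ (Lpart k)^-1)%g.
Proof. by apply/setP=> h; rewrite mem_Hstab_dbiact mem_conjgV. Qed.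

Lemma Sstab_dbiact lam (k g : G) :
  Sstab E (GU E (dbiact k g lam)) = (Sstab E (GU E lam) :^ (Lpart k)^-1)%g.
Proof.
apply/setP=> s; rewrite mem_conjgV !inE GU_dbiact; set r := Lpart k.
rewrite -[RHS](inj_eq (imset_inj (@Adst_inj _ _ _ E r))) -!imset_comp; congr (_ == _).
by apply: eq_imset => mu /=; rewrite -!AdstM -conjgC.
Qed.

Variable eps : F -> algC.
Hypothesis eps_neq0 : forall t, eps t != 0.
Hypothesis epsD : forall s t, eps (s + t) = eps s * eps t.
Hypothesis eps_nontrivial : exists t, eps t != 1.

Lemma cfdot_schar_pairing a b :
  '[schar_of eps a, schar_of eps b] =
  #|{: G}|%:R * schar_coef E (tag b) * pairing eps (schar_of eps a) (tagged b).
Proof.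
rewrite (@cfdotE _ [group of [set: G]]) (eq_bigl xpredT) => [|y]; last by rewrite inE.
rewrite sum_schar_pairing //; last exact: schar_superclass_rel.
rewrite cardsT expr2 (mulrC (schar_coef _ _)) -!mulrA mulKf //.
by rewrite pnatr_eq0 -cardsT (gtn_eqF (cardG_gt0 _)).
Qed.

(** A nonzero scalar product yields k, g carrying lam to mu; conjugation by the
    L-part of k then makes theta an S-irreducible character of the same group as
    eta, and not orthogonal to it, hence equal to it. *)
Lemma schar_of_orthogonal (T : {set dJ}) a b : a \in A0_seq E T -> b \in A0_seq E T ->
  '[schar_of eps a, schar_of eps b] != 0 -> exists r, A_conj r a b.
Proof.
case: a b => [lam theta] [mu eta] /A0P[_ /= Rtheta] /A0P[_ /= Reta].
rewrite cfdot_schar_pairing mulf_eq0 negb_or => /andP[_] /=.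
case/pairing_schar=> // k [g [muE dot_neq0]]; exists (Lpart k); apply/A_conjP.
split=> [|h] /=; first by rewrite muE GU_dbiact.
have [eta' Reta' eta'E] : exists2 eta', eta' \in rel_irr (H mu) (S mu) &
    forall h, eta' h = theta (h ^ Lpart k)%g.
  apply: rel_irr_conj Rtheta; [exact: Hstab_normal | exact: Hstab_normal | |] => /=.
    by rewrite muE Hstab_dbiact.
  by rewrite muE Sstab_dbiact.
rewrite -eta'E; congr (fun_of_cfun _ h); apply: rel_irr_eq Reta Reta' _; first exact: Hstab_normal.
rewrite cfdotC fmorph_eq0 cfdotE mulf_neq0 ?invr_eq0 ?neq0CG //.
apply: contraNneq dot_neq0 => dot0; rewrite -[X in _ == X]dot0 [X in _ == X]big_mkcond.
apply/eqP/eq_bigr => z _; rewrite eta'E; case: ifPn => // nHz.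
by rewrite [eta z]cfun0 // rmorph0 mulr0.
Qed.

(** At 1 every term of [schar_formula] equals theta(1). *)
Lemma schar_of1_neq0 (T : {set dJ}) a : a \in A0_seq E T -> schar_of eps a 1%g != 0.
Proof.
case/A0P=> _ /rel_irr1_neq0 theta1; rewrite /schar_of schar_formula // mulrA.
rewrite mulf_neq0 ?schar_coef_neq0 //.
have biact0 k g : biact k g (Jpart (1%g : G)) = 0.
  by rewrite (Jpart1 E); have := biactB k g 0 0; rewrite !subrr.
rewrite (eq_bigr (fun=> \sum_(g : G) tagged a 1%g)) => [|k _]; last first.
  by apply: eq_bigr => g _; rewrite biact0 linear0 eps0 // (Lpart1 E) conj1g mulr1.
rewrite !sumr_const !mulrn_eq0 (negPf theta1) orbF orbb -lt0n.
by apply/card_gt0P; exists 1%g.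
Qed.

Variable T : {set dJ}.
Hypothesis hT : is_transversal T (GU_orbits E) [set: dJ].
Variable repA : {set A0 E T} -> A0 E T.
Hypothesis hrepA : forall alpha, alpha \in A_orbits E T -> repA alpha \in alpha.
Variable repB : {set L * {set {set fJ}}} -> L * {set {set fJ}}.
Hypothesis hrepB : forall beta, beta \in B_orbits E -> repB beta \in beta.

Local Notation chi := [seq schar_of eps (ssval (repA alpha)) | alpha in A_orbits E T].
Local Notation K := [seq sclass E (repB beta) | beta in B_orbits E].

(** Conjugacy under L is an equivalence relation on pairs. *)
Lemma repA_inj : {in A_orbits E T &, forall alpha beta r,
  A_conj r (ssval (repA alpha)) (ssval (repA beta)) -> alpha = beta}.
Proof.
move=> alpha beta Aa Ab r; have := hrepA Aa; have := hrepA Ab.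
case/imsetP: Aa Ab => a _ -> /imsetP[b _ ->].
set a' := repA _; set b' := repA _; rewrite !inE => /existsP[s bs] /existsP[t at_] rab.
apply/setP=> c; rewrite !inE; apply/existsP/existsP=> [] [u uc].
  have := A_conjM bs (A_conjM (A_conjV rab) (A_conjM (A_conjV at_) uc)); by eexists; eassumption.
have := A_conjM at_ (A_conjM rab (A_conjM (A_conjV bs) uc)); by eexists; eassumption.
Qed.

Lemma chi_orthogonal : pairwise_orthogonal chi.
Proof.
have orth : {in A_orbits E T &, forall alpha beta, alpha != beta ->
    '[schar_of eps (ssval (repA alpha)), schar_of eps (ssval (repA beta))] = 0}.
  move=> alpha beta Aa Ab; apply: contraNeq => /(schar_of_orthogonal (ssvalP _) (ssvalP _))[r].
  by move/repA_inj => ->.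
have neq0 alpha : schar_of eps (ssval (repA alpha)) != 0.
  apply: contraNneq (schar_of1_neq0 (ssvalP (repA alpha))) => ->.
  by rewrite cfunE.
apply/pairwise_orthogonalP; split=> [|_ _ /imageP[al Aa ->] /imageP[be Ab ->] ne]; last first.
  by apply: orth => //; apply: contraNneq ne => ->.
rewrite /= map_inj_in_uniq ?enum_uniq => [|al be]; last first.
  rewrite !mem_enum => Aa Ab eq_ab; apply: contraNeq (neq0 be) => /(orth _ _ Aa Ab).
  by rewrite eq_ab => /eqP; rewrite cfnorm_eq0.
by rewrite andbT; apply/imageP=> - [al _ /esym/eqP]; apply/negP.
Qed.

Lemma superclass_rel_of_mem X y z : X \in K -> y \in X -> z \in X -> superclass_rel y z.
Proof.
case/imageP=> _ /B_orbitsP[x ->] ->; rewrite sclass_repB // !inE => /eqP xy /eqP xz.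
by apply/mem_label_orbit; rewrite -label_orbit_eq -xy xz.
Qed.

(** Conjugate pairs give the same pairing with f, so orthogonality to the chosen
    characters is orthogonality to those of all pairs over T; and T meets every
    G x U orbit. *)
Lemma chi_complete (f : G -> algC) :
  (forall X, X \in K -> {in X &, forall x y, f x = f y}) ->
  (forall phi, phi \in chi -> \sum_(y in [set: G]) f y * (phi y)^* = 0) ->
  {in [set: G], forall y, f y = 0}.
Proof.
move=> fK dot0; have f_inv : superclass_invariant f.
  move=> y z yz; have Borb : label_orbit y \in B_orbits E by apply/B_orbitsP; exists y.
  apply: (fK (sclass E (repB (label_orbit y)))); first exact: image_f.
    by rewrite sclass_repB // inE.
  by rewrite sclass_repB // inE label_orbit_eq; apply/mem_label_orbit.
have pair0 a : a \in A0_seq E T -> pairing eps f (tagged a) = 0.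
  move=> Aa; pose al := [set b : A0 E T | [exists r, A_conj r a (ssval b)]].
  have Aal : al \in A_orbits E T by apply/imsetP; exists (SeqSub Aa).
  have := hrepA Aal; rewrite inE => /existsP[r /A_conjP[GUE tE]].
  rewrite -(pairing_conj eps f_inv GUE tE).
  have := dot0 _ (image_f _ Aal); rewrite (eq_bigl xpredT) => [|y]; last by rewrite inE.
  have nz : schar_coef E (tag (ssval (repA al))) * #|{: G}|%:R ^+ 2 != 0.
    apply: mulf_neq0; [exact: schar_coef_neq0 | rewrite expf_neq0 // pnatr_eq0 -lt0n].
    by apply/card_gt0P; exists 1%g.
  by rewrite sum_schar_pairing // => /eqP; rewrite mulf_eq0 (negPf nz) => /eqP.
have four0 lam h : lam \in T -> fourier eps f lam h = 0.
  move=> Tlam; apply: fourier_eq0_of_pairing => // theta Rtheta.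
  by apply: (pair0 (Tagged (fun lam => 'CF(Hstab E (GU E lam))) theta)); apply/A0P.
move=> y _; apply: (fourier_inj eps_neq0 epsD eps_nontrivial (f := f)) => lam h.
have /and3P[_ _ /forall_inP/(_ (GU E lam))] := hT.
rewrite imset_f // => /(_ isT)/eqP cardT.
have /card_gt0P[mu /setIP[Tmu /GUP[k [g [k1 muE]]]]] : (0 < #|T :&: GU E lam|)%N by rewrite cardT.
by rewrite -(four0 _ h Tmu) muE fourier_dbiact // k1 conjg1.
Qed.

Lemma supercharacters : supercharacter_theory chi K.
Proof.
have [uK partK] := sclass_partition hrepB.
have chiK phi X : phi \in chi -> X \in K -> {in X &, forall x y, phi x = phi y}.
  case/imageP=> al _ -> KX y z Xy Xz.
  by apply: schar_superclass_rel => //; apply: superclass_rel_of_mem KX Xy Xz.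
split=> //; last exact: sclass1.
  apply: (size_chi_K (G := [group of [set: G]]) uK partK chi_orthogonal chiK).
  exact: chi_complete.
split; last exact: chi_orthogonal.
move=> _ /imageP[al _ ->]; apply: schar_char => //.
by have /A0P[_ /rel_irr_char] := ssvalP (repA al).
Qed.

End Main.

Theorem theorem4p2 (F : finFieldType) (J : vectType F) (L : finGroupType)
    (E : alg_ext J L)
    (eps : F -> algC)
    (eps_neq0 : forall t, eps t != 0)
    (epsD : forall s t, eps (s + t) = eps s * eps t)
    (eps_nontrivial : exists t, eps t != 1)
    (T : {set dual J})
    (hT : is_transversal T (GU_orbits E) [set: dual J])
    (repA : {set A0 E T} -> A0 E T)
    (hrepA : forall alpha, alpha \in A_orbits E T -> repA alpha \in alpha)
    (repB : {set L * {set {set finvect_type J}}} ->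
            L * {set {set finvect_type J}})
    (hrepB : forall beta, beta \in B_orbits E -> repB beta \in beta) :
  supercharacter_theory
    [seq schar_of eps (ssval (repA alpha)) | alpha in A_orbits E T]
    [seq sclass E (repB beta) | beta in B_orbits E].
Proof.
exact: (supercharacters eps_neq0 epsD eps_nontrivial hT hrepA hrepB).
Qed.
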